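(* Consider the latent Dirichlet allocation model and the procedure ''ECA for LDA'' (both described in the context), with output $\widehat O=\widehat O(\theta)$ on input $\theta\in\mathbb{R}^k$ and the exact modified moments $\mathrm{Pairs}_{\alpha_0}$, $\mathrm{Triples}_{\alpha_0}(\cdot)$. Then: (1) (No false positives) For all $\theta\in\mathbb{R}^k$, the procedure returns a subset of the columns of $O$. (2) (Topic recovery) If $\theta$ is a random vector uniformly distributed on the unit sphere $\mathcal{S}^{k-1}\subset\mathbb{R}^k$, then with probability $1$ the procedure returns all columns of $O$ (i.e. $\widehat O$ equals the set of columns of $O$). (3) (Parameter recovery) $$\alpha=\alpha_0(\alpha_0+1)\,O^+\,\mathrm{Pairs}_{\alpha_0}\,(O^+)^\top\,\vec 1,$$ where $\vec 1\in\mathbb{R}^k$ is the vector of all ones.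
   Context: LDA model. $\alpha=(\alpha_1,\dots,\alpha_k)$ has strictly positive entries and $\alpha_0:=\alpha_1+\dots+\alpha_k$. The hidden vector $h$ takes values in the probability simplex $\Delta^{k-1}$ and has the Dirichlet distribution with parameter $\alpha$, i.e. density $p_\alpha(h)=\frac{\Gamma(\alpha_0)}{\prod_i\Gamma(\alpha_i)}\prod_{i=1}^kh_i^{\alpha_i-1}$. $O\in\mathbb{R}^{d\times k}$, $d\ge k$, has full rank $k$ and each of its columns is a probability vector on $d$ outcomes. Given $h$, the observations $x_1,x_2,x_3,\dots$ are conditionally i.i.d.: for each $v$, an index $i\in\{1,\dots,k\}$ is drawn from the distribution $h$, then an outcome $j\in\{1,\dots,d\}$ is drawn from the $i$-th column of $O$, and $x_v=e_j\in\mathbb{R}^d$ (the $j$-th standard basis vector). Hence $\mathbb{E}[x_v\mid h]=Oh$. Modified moments. $\mu:=\mathbb{E}[x_1]$, $$\mathrm{Pairs}_{\alpha_0}:=\mathbb{E}[x_1x_2^\top]-\frac{\alpha_0}{\alpha_0+1}\mu\mu^\top,$$ and for $\eta\in\mathbb{R}^d$, $$\mathrm{Triples}_{\alpha_0}(\eta):=\mathbb{E}[x_1x_2^\top\langle\eta,x_3\rangle]-\frac{\alpha_0}{\alpha_0+2}\Bigl(\mathbb{E}[x_1x_2^\top]\eta\mu^\top+\mu\eta^\top\mathbb{E}[x_1x_2^\top]+\langle\eta,\mu\rangle\mathbb{E}[x_1x_2^\top]\Bigr)+\frac{2\alpha_0^2}{(\alpha_0+2)(\alpha_0+1)}\langle\eta,\mu\rangle\mu\mu^\top.$$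 Pseudo-inverse. For a matrix $A$ with linearly independent columns, $A^+=(A^\top A)^{-1}A^\top$. Procedure ''ECA for LDA'' (input $\theta\in\mathbb{R}^k$, $\mathrm{Pairs}_{\alpha_0}$, $\mathrm{Triples}_{\alpha_0}(\cdot)$): (i) choose any $U\in\mathbb{R}^{d\times k}$ with $\mathrm{Range}(U)=\mathrm{Range}(\mathrm{Pairs}_{\alpha_0})$; (ii) choose any $V\in\mathbb{R}^{k\times k}$ such that $V^\top(U^\top\mathrm{Pairs}_{\alpha_0}U)V$ is the $k\times k$ identity, and set $W=UV$; (iii) let $\Lambda$ be the set of (unit-norm) left singular vectors of $W^\top\mathrm{Triples}_{\alpha_0}(W\theta)W$ whose singular values are unique (of multiplicity one), one vector, determined up to sign, per such singular value; (iv) return $$\widehat O=\Bigl\{\frac{(W^+)^\top\lambda}{\vec 1^\top(W^+)^\top\lambda}:\lambda\in\Lambda\Bigr\},$$ where here $\vec 1\in\mathbb{R}^d$ is the all-ones vector. *)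

(* Defs.v *)
From HB Require Import structures.
From mathcomp Require Import all_boot all_order all_algebra.
From mathcomp Require Import all_classical all_reals all_analysis.

Set Implicit Arguments.
Unset Strict Implicit.
Unset Printing Implicit Defensive.

Import Order.TTheory GRing.Theory Num.Theory.
Import numFieldNormedType.Exports.

Local Open Scope classical_set_scope.
Local Open Scope ring_scope.

(* Random vectors take values in n.-tuple R, which carries the product (Borel)
   sigma-algebra in the library; linear algebra is done on column vectors. *)
Definition cV_of_tuple (R : realType) (n : nat) (t : n.-tuple R) : 'cV[R]_n :=
  \col_i tnth t i.

Definition tuple_of_cV (R : realType) (n : nat) (v : 'cV[R]_n) : n.-tuple R :=
  [tuple v i 0 | i < n].

(* The library norm `|v| on matrices is the max norm, so Euclidean notions go
   through the scalar product. *)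
Definition dotv (R : realType) (n : nat) (u v : 'cV[R]_n) : R :=
  (u^T *m v) 0 0.

Definition ones (R : realType) (n : nat) : 'cV[R]_n := const_mx 1.

Definition colpinv (R : realType) (m n : nat) (A : 'M[R]_(m, n)) : 'M[R]_(n, m) :=
  invmx (A^T *m A) *m A^T.

Definition columns (R : realType) (m n : nat) (A : 'M[R]_(m, n)) :
    set 'cV[R]_m :=
  range (fun i : 'I_n => col i A).

Definition Gamma (R : realType) (a : R) : R :=
  \int[lebesgue_measure]_(t in `]0, +oo[) (t `^ (a - 1) * expR (- t)).

(* Iterated integral over R^n; by Tonelli it is the integral with respect to
   n-dimensional Lebesgue measure whenever f is nonnegative and Borel. *)
Fixpoint integral_Rn (R : realType) (n : nat) :
    (n.-tuple R -> \bar R) -> \bar R :=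
  match n with
  | 0 => fun f => f [tuple]
  | m.+1 => fun f => (\int[@lebesgue_measure R]_t
                        integral_Rn (fun x : m.-tuple R => f [tuple of t :: x]))%E
  end.

Definition simplex (R : realType) (k : nat) : set (k.-tuple R) :=
  [set p | (forall i, 0 <= tnth p i) /\ \sum_i tnth p i = 1].

Definition dirichlet_density (R : realType) (k : nat) (alpha : 'I_k -> R)
    (p : k.-tuple R) : R :=
  Gamma (\sum_i alpha i) / (\prod_i Gamma (alpha i)) *
  \prod_i (tnth p i) `^ (alpha i - 1).

(* The point of R^(n+1) with coordinate sum 1 whose first n coordinates are
   those of x. *)
Definition simplex_point (R : realType) (n : nat) (x : n.-tuple R) :
    n.+1.-tuple R :=
  [tuple of rcons x (1 - \sum_i tnth x i)].

(* The density of the Dirichlet law is relative to Lebesgue measure in the first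
   k - 1 coordinates, with k = n.+1. *)
Definition dirichlet_distributed (R : realType) (n : nat)
    (alpha : 'I_n.+1 -> R) (dO : measure_display) (Omega : measurableType dO)
    (P : probability Omega R) (h : {RV P >-> n.+1.-tuple R}) : Prop :=
  forall B : set (n.+1.-tuple R), measurable B ->
    distribution P h B =
    integral_Rn (fun x : n.-tuple R =>
      (\1_(B `&` @simplex R n.+1) (simplex_point x) *
       dirichlet_density alpha (simplex_point x))%:E).

Definition topic_matrix (R : realType) (d k : nat) (O : 'M[R]_(d, k)) : Prop :=
  \rank O = k /\
  forall i, (forall j, 0 <= O j i) /\ \sum_j O j i = 1.

(* z v is the index drawn from h and y v the outcome drawn from column z v of O.
   The last clause says that, conditionally on h, the pairs (z v, y v) are
   independent with P(z v = i, y v = j | h) = h_i * O j i. *)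
Definition lda_sampling (R : realType) (d k : nat) (O : 'M[R]_(d, k))
    (dO : measure_display) (Omega : measurableType dO)
    (P : probability Omega R) (h : {RV P >-> k.-tuple R})
    (z : nat -> Omega -> 'I_k) (y : nat -> Omega -> 'I_d) : Prop :=
  [/\ forall v i, measurable [set w | z v w = i],
      forall v j, measurable [set w | y v w = j] &
      forall (N : nat) (i : 'I_N -> 'I_k) (j : 'I_N -> 'I_d)
             (B : set (k.-tuple R)), measurable B ->
        P (h @^-1` B `&`
           [set w | forall v : 'I_N, z v w = i v /\ y v w = j v]) =
        (\int[P]_(w in h @^-1` B)
           (\prod_(v < N) (tnth (h w) (i v) * O (j v) (i v)))%:E)%E].

Definition observation (R : realType) (d : nat) (dO : measure_display)
    (Omega : measurableType dO) (y : nat -> Omega -> 'I_d) (v : nat)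
    (w : Omega) : 'cV[R]_d :=
  delta_mx (y v w) 0.

Section Moments.
Context (R : realType) (dO : measure_display) (Omega : measurableType dO).
Variable P : probability Omega R.

Definition mean_mx (m n : nat) (X : Omega -> 'M[R]_(m, n)) : 'M[R]_(m, n) :=
  \matrix_(i, j) fine ('E_P[fun w => X w i j])%E.

(* Three observations suffice: x 0, x 1 and x 2, with indices starting at 0. *)
Variables (d : nat) (x : nat -> Omega -> 'cV[R]_d) (alpha0 : R).

Definition first_moment : 'cV[R]_d := mean_mx (x 0%N).

Definition second_moment : 'M[R]_d := mean_mx (fun w => x 0%N w *m (x 1%N w)^T).

Definition third_moment (eta : 'cV[R]_d) : 'M[R]_d :=
  mean_mx (fun w => dotv eta (x 2%N w) *: (x 0%N w *m (x 1%N w)^T)).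

Definition Pairs : 'M[R]_d :=
  second_moment
  - (alpha0 / (alpha0 + 1)) *: (first_moment *m first_moment^T).

Definition Triples (eta : 'cV[R]_d) : 'M[R]_d :=
  third_moment eta
  - (alpha0 / (alpha0 + 2)) *:
      (second_moment *m eta *m first_moment^T
       + first_moment *m eta^T *m second_moment
       + dotv eta first_moment *: second_moment)
  + (2 * alpha0 ^+ 2 / ((alpha0 + 2) * (alpha0 + 1))
       * dotv eta first_moment) *: (first_moment *m first_moment^T).

End Moments.

Definition left_singular_vector (R : realType) (m n : nat) (A : 'M[R]_(m, n))
    (s : R) (u : 'cV[R]_m) : Prop :=
  [/\ 0 <= s, dotv u u = 1 &
      exists v : 'cV[R]_n, [/\ dotv v v = 1, A *m v = s *: u & A^T *m u = s *: v]].

(* The multiplicity of a singular value s of A is the dimension of the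
   s^2-eigenspace of the symmetric matrix A A^T; the eigenspace is nonzero
   exactly when s is a singular value. *)
Definition unique_singular_value (R : realType) (n : nat) (A : 'M[R]_n)
    (s : R) : Prop :=
  0 <= s /\ \rank (eigenspace (A *m A^T) (s ^+ 2)) = 1%N.

(* Lambda holds one unit left singular vector, with an arbitrary sign, for each
   singular value of multiplicity one, and nothing else. *)
Definition unique_left_singular_vectors (R : realType) (n : nat) (A : 'M[R]_n)
    (Lambda : set 'cV[R]_n) : Prop :=
  (forall u, Lambda u ->
     exists s, unique_singular_value A s /\ left_singular_vector A s u) /\
  (forall s, unique_singular_value A s ->
     exists! u, Lambda u /\ left_singular_vector A s u).

Definition eca_whitening (R : realType) (d k : nat) (Prs : 'M[R]_d)
    (U : 'M[R]_(d, k)) (V : 'M[R]_k) : Prop :=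
  range (fun v : 'cV[R]_k => U *m v) = range (fun v : 'cV[R]_d => Prs *m v) /\
  V^T *m (U^T *m Prs *m U) *m V = 1%:M.

(* eca_output Trs theta U V S: given the choices U and V, the procedure can
   return S, for some choice of signs of the singular vectors. *)
Definition eca_output (R : realType) (d k : nat) (Trs : 'cV[R]_d -> 'M[R]_d)
    (theta : 'cV[R]_k) (U : 'M[R]_(d, k)) (V : 'M[R]_k) (S : set 'cV[R]_d) :
    Prop :=
  let W := U *m V in
  exists Lambda : set 'cV[R]_k,
    unique_left_singular_vectors (W^T *m Trs (W *m theta) *m W) Lambda /\
    S = [set (dotv (ones R d) ((colpinv W)^T *m l))^-1 *: ((colpinv W)^T *m l)
        | l in Lambda].

(* The uniform distribution on the unit sphere is the probability law carried by
   the sphere and invariant under the orthogonal group O(k). *)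
Definition uniform_on_sphere (R : realType) (k : nat) (dT : measure_display)
    (T : measurableType dT) (Q : probability T R)
    (theta : {RV Q >-> k.-tuple R}) : Prop :=
  distribution Q theta [set t | dotv (cV_of_tuple t) (cV_of_tuple t) = 1]
    = 1%E /\
  forall (G : 'M[R]_k) (B : set (k.-tuple R)),
    G^T *m G = 1%:M -> measurable B ->
    distribution Q theta [set t | B (tuple_of_cV (G *m cV_of_tuple t))] =
    distribution Q theta B.

(* Main.v *)
(* The law of h is an iterated integral of powers over the simplex, which factors
   into one-dimensional Beta integrals; integration by parts gives their ratios,
   hence (the total mass being 1) the moments of h up to order 3, without
   evaluating Gamma. They yield Pairs = O D^2 O^T with D diagonal and positive, and
   Triples(eta) = c O D^2 diag(O^T eta) O^T with c > 0. Whitening makes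
   M := W^T O D orthogonal, so that W^T Triples(W theta) W = M diag(lam) M^T with
   lam_i = c (O^T W theta)_i: a singular value of multiplicity one has a left
   singular vector proportional to a column of M, which (W^+)^T sends to a multiple
   of a column of O. The |lam_i| are pairwise distinct unless theta lies in one of
   finitely many hyperplanes, and these are null for the uniform distribution. *)

Require Import Defs.
From HB Require Import structures.
From mathcomp Require Import all_boot all_order all_algebra.
From mathcomp Require Import all_classical all_reals all_analysis.
From mathcomp Require Import finmap measurable_realfun ring lra.

Set Implicit Arguments.
Unset Strict Implicit.
Unset Printing Implicit Defensive.

Import Order.TTheory GRing.Theory Num.Theory.
Import numFieldNormedType.Exports.

Local Open Scope classical_set_scope.
Local Open Scope ring_scope.

(** * Iterated Lebesgue integrals *)

(** Convergence of the Beta integrals is obtained only at the end. Their recurrences are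
    multiplicative identities in [\bar R], valid for the value +oo too; since the law of h has mass
    1, the normalizing constant times a product of Beta integrals is 1, which forces the constant to
    be positive and the product finite, and the recurrences pass finiteness on to the moments. Only
    monomials of degree three are integrated: the coordinates of h and the columns of O sum to 1, so
    lower orders are marginals. The weights in Pairs and Triples are those for which all but the
    diagonal cancels, which gives D_i^2 = alpha_i / (alpha0 (alpha0 + 1)) and c = 2 / (alpha0 + 2).
    Exceptional values of theta lie on two hyperplanes for each pair of topics, because the singular
    values are |lam_i| and lam_j^2 - lam_i^2 = (lam_j - lam_i)(lam_j + lam_i). *)

Section integral_Rn.
Context (R : realType).
Local Open Scope ereal_scope.

Lemma integral_Rn_ge0 n (f : n.-tuple R -> \bar R) :
  (forall x, 0 <= f x) -> 0 <= integral_Rn f.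
Proof.
elim: n f => [f f0 //=|n IH f f0 /=].
by apply: integral_ge0 => t _; apply: IH => x.
Qed.

(** The parameter space is arbitrary because the induction enlarges it: the next coordinate joins
    the parameter, [T] becomes [T * R], and Tonelli then integrates that coordinate out. *)
Lemma measurable_integral_Rn d (T : measurableType d) n
    (f : T * n.-tuple R -> \bar R) :
  measurable_fun setT f -> (forall x, 0 <= f x) ->
  measurable_fun [set: T] (fun x => integral_Rn (fun y => f (x, y))).
Proof.
elim: n d T f => [|n IH] d T f mf f0 /=.
  by apply: (measurableT_comp mf); exact: measurable_fun_pair.
pose g (z : T * R) := integral_Rn (fun y => f (z.1, [tuple of z.2 :: y])).
have mg : measurable_fun setT g.
  apply: (IH _ _ (fun u : (T * R) * n.-tuple R =>
     f (u.1.1, [tuple of u.1.2 :: u.2]))) => //.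
  apply: (measurableT_comp mf); apply: measurable_fun_pair.
    exact: (measurableT_comp measurable_fst measurable_fst).
  apply: measurable_cons => //.
  exact: (measurableT_comp measurable_snd measurable_fst).
apply: (@measurable_fun_fubini_tonelli_F _ _ T _ R (@lebesgue_measure R) g) => //.
by move=> x; apply: integral_Rn_ge0.
Qed.

Lemma measurable_fun_cons_l n (f : n.+1.-tuple R -> \bar R) (t : R) :
  measurable_fun setT f ->
  measurable_fun setT (fun y : n.-tuple R => f [tuple of t :: y]).
Proof. by move=> mf; apply: (measurableT_comp mf); exact: measurable_cons. Qed.

Lemma measurable_integral_Rn_cons n (f : n.+1.-tuple R -> \bar R) :
  measurable_fun setT f -> (forall x, 0 <= f x) ->
  measurable_fun [set: R]
    (fun t => integral_Rn (fun y : n.-tuple R => f [tuple of t :: y])).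
Proof.
move=> mf f0.
apply: (@measurable_integral_Rn _ R n (fun u => f [tuple of u.1 :: u.2])) => //.
by apply: (measurableT_comp mf); exact: measurable_cons.
Qed.

Lemma integral_Rn_ZL n (f : n.-tuple R -> \bar R) (c : R) :
  measurable_fun setT f -> (forall x, 0 <= f x) -> (0 <= c)%R ->
  integral_Rn (fun x => c%:E * f x) = c%:E * integral_Rn f.
Proof.
move=> + + c0; elim: n f => [//|n IH] f mf f0 /=.
under eq_integral do (rewrite IH//; last exact: measurable_fun_cons_l).
rewrite ge0_integralZl//; first exact: measurable_integral_Rn_cons.
by move=> t _; exact: integral_Rn_ge0.
Qed.

Lemma integral_Rn_sum n (I : Type) (s : seq I) (f : I -> n.-tuple R -> \bar R) :
  (forall i, measurable_fun setT (f i)) -> (forall i x, 0 <= f i x) ->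
  integral_Rn (fun x => \sum_(i <- s) f i x) = \sum_(i <- s) integral_Rn (f i).
Proof.
elim: n f => [//|n IH] f mf f0 /=.
under eq_integral do (rewrite IH//; last by move=> i; exact: measurable_fun_cons_l).
rewrite ge0_integral_sum//; first by move=> i; exact: measurable_integral_Rn_cons.
by move=> i t _; exact: integral_Rn_ge0.
Qed.

Lemma le_integral_Rn n (f g : n.-tuple R -> \bar R) :
  measurable_fun setT f -> measurable_fun setT g ->
  (forall x, 0 <= f x) -> (forall x, f x <= g x) ->
  integral_Rn f <= integral_Rn g.
Proof.
elim: n f g => [f g _ _ _ fg|n IH f g mf mg f0 fg] /=; first exact: fg.
have g0 x : 0 <= g x by exact: le_trans (fg x).
apply: ge0_le_integral => //.
- by move=> t _; exact: integral_Rn_ge0.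
- exact: measurable_integral_Rn_cons.
- exact: measurable_integral_Rn_cons.
- by move=> t _; apply: IH => //; exact: measurable_fun_cons_l.
Qed.

Lemma integral_Rn_cvg n (f : (n.-tuple R -> \bar R)^nat) (g : n.-tuple R -> \bar R) :
  (forall m, measurable_fun setT (f m)) -> (forall m x, 0 <= f m x) ->
  (forall x, nondecreasing_seq (f ^~ x)) -> (forall x, f ^~ x @ \oo --> g x) ->
  integral_Rn (f m) @[m --> \oo] --> integral_Rn g.
Proof.
elim: n f g => [f g _ _ _ fg|n IH f g mf f0 nd fg] /=; first exact: fg.
rewrite (_ : (fun t => integral_Rn (fun y : n.-tuple R => g [tuple of t :: y])) =
  (fun t => limn (fun m => integral_Rn (fun y : n.-tuple R => f m [tuple of t :: y])))).
  apply: cvg_monotone_convergence => //.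
  - by move=> m; exact: measurable_integral_Rn_cons.
  - by move=> m t _; exact: integral_Rn_ge0.
  - move=> t _ a b ab; apply: le_integral_Rn => //.
    + exact: measurable_fun_cons_l.
    + exact: measurable_fun_cons_l.
    + by move=> x; exact: nd.
apply/funext => t; apply/esym/cvg_lim => //.
by apply: IH => // m; exact: measurable_fun_cons_l.
Qed.

Import HBNNSimple.

(** Turns a law given by its values on sets into a formula for expectations: linearity for simple
    functions, then monotone convergence on both sides. *)
Lemma integral_density_Rn n d (T : measurableType d) (mu : {measure set T -> \bar R})
    (s : n.-tuple R -> T) (phi : n.-tuple R -> R) (g : T -> R) :
  measurable_fun setT s -> measurable_fun setT phi -> (forall x, (0 <= phi x)%R) ->
  measurable_fun setT g -> (forall y, (0 <= g y)%R) ->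
  (forall B, measurable B -> mu B = integral_Rn (fun x => (\1_B (s x) * phi x)%:E)) ->
  \int[mu]_y (g y)%:E = integral_Rn (fun x => (g (s x) * phi x)%:E).
Proof.
move=> ms mphi phi0 mg g0 muE.
have mg' : measurable_fun setT (EFin \o g) by exact/measurable_EFinP.
pose g_ := nnsfun_approx measurableT mg'.
have g_cvg y : EFin \o g_^~ y @ \oo --> (g y)%:E.
  by apply: (@cvg_nnsfun_approx _ _ _ _ measurableT _ mg') => // x _; rewrite lee_fin.
have mind B : measurable B -> measurable_fun setT (fun x => (\1_B (s x) * phi x)%:E).
  move=> mB; apply/measurable_EFinP; apply: measurable_funM => //.
  exact: (measurableT_comp (measurable_indic _)).
have g_int m : \int[mu]_y (g_ m y)%:E = integral_Rn (fun x => (g_ m (s x) * phi x)%:E).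
  rewrite integralT_nnsfun sintegralE fsbig_finite//=.
  have rge0 (r : R) : r \in fset_set (range (g_ m)) -> (0 <= r)%R.
    by rewrite in_fset_set// => /set_mem[y _ <-].
  (* The coefficient is written [|r|] because [integral_Rn_sum] asks for nonnegative terms at every
     index r, not only at the values of [g_ m]. *)
  transitivity (integral_Rn (fun x => \sum_(r <- fset_set (range (g_ m)))
      (`|r|%:E * (\1_(g_ m @^-1` [set r]) (s x) * phi x)%:E))).
    rewrite integral_Rn_sum; last 2 first.
    - move=> r; apply: emeasurable_funM; first exact: measurable_cst.
      exact: mind.
    - by move=> r x; rewrite mule_ge0// lee_fin mulr_ge0.
    rewrite big_seq [RHS]big_seq; apply: eq_bigr => r /rge0 r0.
    rewrite integral_Rn_ZL//; [by rewrite muE// ger0_norm| exact: mind|].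
    by move=> x; rewrite lee_fin mulr_ge0.
  congr integral_Rn; apply/funext => x.
  rewrite [X in (X * _)%R]fimfunE fsbig_finite//= mulr_suml -sumEFin.
  rewrite big_seq [RHS]big_seq; apply: eq_bigr => r /rge0 r0.
  by rewrite ger0_norm// -EFinM mulrA.
have lhs : \int[mu]_y (g_ m y)%:E @[m --> \oo] --> \int[mu]_y (g y)%:E.
  rewrite [X in _ --> X](_ : _ = \int[mu]_y limn (fun m => (g_ m y)%:E)); last first.
    by apply: eq_integral => y _; apply/esym/cvg_lim => //; exact: g_cvg.
  apply: cvg_monotone_convergence => //.
  - by move=> m; exact/measurable_EFinP/measurable_funP.
  - by move=> m y _; rewrite lee_fin.
  - by move=> y _ a b ab; rewrite lee_fin; exact/lefP/nd_nnsfun_approx.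
have rhs : \int[mu]_y (g_ m y)%:E @[m --> \oo] -->
    integral_Rn (fun x => (g (s x) * phi x)%:E).
  under eq_fun do rewrite g_int.
  apply: integral_Rn_cvg.
  - move=> m; apply/measurable_EFinP; apply: measurable_funM => //.
    exact: (measurableT_comp (measurable_funP (g_ m))).
  - by move=> m x; rewrite lee_fin mulr_ge0.
  - move=> x a b ab; rewrite lee_fin ler_wpM2r//.
    exact/lefP/nd_nnsfun_approx.
  - move=> x; under eq_fun do rewrite EFinM.
    rewrite EFinM; apply: cvgeZr => //; exact: g_cvg.
by rewrite -(cvg_lim _ lhs)// -(cvg_lim _ rhs).
Qed.

End integral_Rn.

(** * Beta and Dirichlet integrals *)

Section scaling.
Context (R : realType).
Local Notation mu := (@lebesgue_measure R).
Local Open Scope ereal_scope.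

Let measurable_scale (c : R) :
  measurable_fun [set: measurableTypeR R] ( *%R c : _ -> measurableTypeR R).
Proof. exact: measurable_funM. Qed.

Let pushforward_scale (c : R) : {measure set (measurableTypeR R) -> \bar R} :=
  measure_function_pushforward__canonical__measure_function_Measure mu
    (measurable_scale c).

(** The left side is a measure in A that agrees with Lebesgue measure on bounded intervals, hence
    everywhere by uniqueness. *)
Lemma lebesgue_measureM (c : R) (A : set R) : (0 < c)%R -> measurable A ->
  c%:E * mu ( *%R c @^-1` A) = mu A.
Proof.
move=> c0 mA.
pose m := mscale (NngNum (ltW c0)) (pushforward_scale c).
apply/esym/(@lebesgue_measure_unique _ m) => //= _ [[a b]] _ <-.
rewrite /mscale/= /pushforward.
rewrite (_ : *%R c @^-1` _ = [set` `]a / c, b / c]%R]).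
  rewrite !lebesgue_measure_itv/= !lte_fin ltr_pM2r ?invr_gt0//.
  case: ifPn => _; last by rewrite mule0.
  by rewrite -!EFinB -EFinM -mulrBl mulrC divfK ?gt_eqF.
by apply/seteqP; split => x /=; rewrite !in_itv/= ltr_pdivrMr// ler_pdivlMr// mulrC.
Qed.

Lemma ge0_integral_scale (f : R -> \bar R) (c : R) : (0 < c)%R ->
  measurable_fun setT f -> (forall x, 0 <= f x) ->
  \int[mu]_t f t = c%:E * \int[mu]_t f (c * t)%R.
Proof.
move=> c0 mf f0.
pose m := mscale (NngNum (ltW c0)) (pushforward_scale c).
transitivity (\int[m]_t f t).
  by apply: eq_measure_integral => A mA _; apply/esym/lebesgue_measureM.
rewrite ge0_integral_mscale//= ge0_integral_pushforward//.
Qed.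

End scaling.

Section beta.
Context (R : realType).
Local Notation mu := (@lebesgue_measure R).
Local Open Scope ereal_scope.
Implicit Types a b c : R.

(** Euler's Beta integral, kept in [\bar R] so that its recurrences can be stated before it is known
    to be finite. *)
Definition Beta a b : \bar R :=
  \int[mu]_(t in `]0%R, 1%R[) (t `^ (a - 1) * (1 - t) `^ (b - 1))%:E.

Lemma measurable_powR_mul D (a b c : R) :
  measurable_fun D (fun t : R => t `^ a * (c - t) `^ b)%R.
Proof.
apply: measurable_funTS; apply: measurable_funM; first exact: measurable_powR.
by apply: (measurableT_comp (measurable_powR _)); exact: measurable_funB.
Qed.

Lemma Beta_ge0 a b : 0 <= Beta a b.
Proof.
by apply: integral_ge0 => t _; rewrite lee_fin mulr_ge0// powR_ge0.
Qed.

(** Multiply the integrand by t + (1 - t) = 1. *)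
Lemma BetaD a b : (0 < a)%R -> (0 < b)%R -> Beta a b = Beta (a + 1) b + Beta a (b + 1).
Proof.
move=> a0 b0; rewrite /Beta -ge0_integralD//; last 4 first.
- by move=> t _; rewrite lee_fin mulr_ge0// powR_ge0.
- by apply/measurable_EFinP; exact: measurable_powR_mul.
- by move=> t _; rewrite lee_fin mulr_ge0// powR_ge0.
- by apply/measurable_EFinP; exact: measurable_powR_mul.
apply: eq_integral => t /set_mem; rewrite /= in_itv/= => /andP[t0 t1].
rewrite -EFinD; congr (_%:E).
have s0 : (0 < 1 - t)%R by rewrite subr_gt0.
rewrite (_ : a + 1 - 1 = (a - 1) + 1)%R; last by ring.
rewrite (_ : b + 1 - 1 = (b - 1) + 1)%R; last by ring.
rewrite !powRD ?(gt_eqF t0) ?(gt_eqF s0) ?implybT// !powRr1 ?ltW//.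
by ring.
Qed.

Lemma is_derive1_powR_onem b (t : R) : (t < 1)%R ->
  is_derive t 1%R (fun t : R => (1 - t) `^ b)%R (- (b * (1 - t) `^ (b - 1)))%R.
Proof.
move=> t1; have s0 : (0 < 1 - t)%R by rewrite subr_gt0.
have := @is_derive1_comp _ (@powR R ^~ b) (fun t : R => 1 - t)%R t _ (-1)%R
  (is_derive1_powR b s0).
rewrite mulrN1; apply.
by apply: is_derive_eq; rewrite add0r mul1r.
Qed.

Lemma cvg_invSSn0 : ((n.+3%:R^-1 : R)%R @[n --> \oo] --> 0%R)%classic.
Proof. by have := @cvg_harmonic R; rewrite -cvg_shiftS -cvg_shiftS. Qed.

(** Makes the boundary terms of the integration by parts vanish: as stated at the end 0, with a and
    b exchanged at the end 1. *)
Lemma cvg_powR_mul a b : (0 < a)%R -> (0 < b)%R ->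
  ((n.+3%:R^-1 `^ a * (1 - n.+3%:R^-1) `^ b : R)%R @[n --> \oo] --> 0%R)%classic.
Proof.
move=> a0 b0.
apply: (@squeeze_cvgr _ _ _ _ (cst 0%R) (fun n => (n.+3%:R^-1 `^ a)%R)).
- apply: nearW => n; rewrite /= mulr_ge0 ?powR_ge0//= ler_piMr ?powR_ge0//.
  apply: (@le_trans _ _ (1 `^ b)%R); last by rewrite powR1.
  have e0 : (0 <= 1 - n.+3%:R^-1 :> R)%R by rewrite subr_ge0 invf_le1// ler1n.
  by apply: ge0_ler_powR; rewrite ?nnegrE ?gerBl// ltW.
- exact: cvg_cst.
- have /cvg_at_rightP/(_ (fun n => n.+3%:R^-1)%R) := powR_cvg0 a0; apply.
  by split; [move=> n; rewrite invr_gt0|exact: cvg_invSSn0].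
Qed.

(** Integration of the derivative of t^a (1 - t)^b. Each side carries one boundary term, so that all
    terms are nonnegative and nothing is subtracted in [\bar R]. *)
Lemma Beta_by_parts_itv a b x y : (0 < a)%R -> (0 < b)%R ->
  (0 < x)%R -> (x < y)%R -> (y < 1)%R ->
  a%:E * \int[mu]_(t in `[x, y]) (t `^ (a - 1) * (1 - t) `^ (b + 1 - 1))%:E
    + (x `^ a * (1 - x) `^ b)%:E =
  b%:E * \int[mu]_(t in `[x, y]) (t `^ (a + 1 - 1) * (1 - t) `^ (b - 1))%:E
    + (y `^ a * (1 - y) `^ b)%:E.
Proof.
move=> a0 b0 x0 xy y1.
have itv0 t : t \in `[x, y]%R -> (0 < t)%R.
  by rewrite in_itv/= => /andP[xt _]; exact: lt_le_trans xt.
have itv1 t : t \in `[x, y]%R -> (t < 1)%R.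
  by rewrite in_itv/= => /andP[_ ty]; exact: le_lt_trans y1.
have sub_oo t : t \in `]x, y[%R -> t \in `[x, y]%R by exact: subset_itv_oo_cc.
have dF c t : t \in `[x, y]%R -> derivable (fun t : R => t `^ c)%R t 1%R.
  by move=> /itv0 t0; have [] := is_derive1_powR c t0.
have dG c t : t \in `[x, y]%R -> derivable (fun t : R => (1 - t) `^ c)%R t 1%R.
  by move=> /itv1 t1; have [] := is_derive1_powR_onem c t1.
have xI : x \in `[x, y]%R by rewrite in_itv/= lexx ltW.
have yI : y \in `[x, y]%R by rewrite in_itv/= lexx ltW.
have LR (f : R -> R) : (forall t, t \in `[x, y]%R -> derivable f t 1%R) ->
    derivable_oo_LRcontinuous f x y.
  move=> df; split=> [t /sub_oo/df//||].
    apply: cvg_at_right_filter; apply: differentiable_continuous.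
    by apply/derivable1_diffP; exact: df.
  apply: cvg_at_left_filter; apply: differentiable_continuous.
  by apply/derivable1_diffP; exact: df.
have := @integration_by_parts R (fun t => t `^ a)%R (fun t => (1 - t) `^ b)%R
  (fun t => a * t `^ (a - 1))%R (fun t => - (b * (1 - t) `^ (b - 1)))%R x y xy.
have -> : \int[mu]_(t in `[x, y]) (t `^ a * - (b * (1 - t) `^ (b - 1)))%:E =
    - (b%:E * \int[mu]_(t in `[x, y]) (t `^ (a + 1 - 1) * (1 - t) `^ (b - 1))%:E).
  rewrite addrK -ge0_integralZl//; last 3 first.
  - by apply/measurable_EFinP; exact: measurable_powR_mul.
  - by move=> t _; rewrite lee_fin mulr_ge0// powR_ge0.
  - by rewrite lee_fin ltW.
  rewrite -integral_ge0N; last first.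
    by move=> t _; rewrite lee_fin !mulr_ge0 ?powR_ge0// ltW.
  by apply: eq_integral => t _; rewrite -EFinM -EFinN; congr EFin; ring.
have -> : \int[mu]_(t in `[x, y]) (a * t `^ (a - 1) * (1 - t) `^ b)%:E =
    a%:E * \int[mu]_(t in `[x, y]) (t `^ (a - 1) * (1 - t) `^ (b + 1 - 1))%:E.
  rewrite addrK -ge0_integralZl//; last 3 first.
  - by apply/measurable_EFinP; exact: measurable_powR_mul.
  - by move=> t _; rewrite lee_fin mulr_ge0// powR_ge0.
  - by rewrite lee_fin ltW.
  by apply: eq_integral => t _; rewrite -EFinM mulrA.
set X := \int[mu]_(t in _) _; set Y := \int[mu]_(t in _) _.
have X0 : 0 <= X by apply: integral_ge0 => t _; rewrite lee_fin mulr_ge0// powR_ge0.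
have Y0 : 0 <= Y by apply: integral_ge0 => t _; rewrite lee_fin mulr_ge0// powR_ge0.
move=> H.
have {H} : - (b%:E * X) = (y `^ a * (1 - y) `^ b - x `^ a * (1 - x) `^ b)%:E - a%:E * Y.
  apply: H.
  - apply: derivable_within_continuous => t tI.
    by apply: derivableM; [exact: derivable_cst|exact: dF].
  - exact/LR/dF.
  - move=> t /sub_oo/itv0 t0; rewrite derive1E.
    by have [_ ->] := is_derive1_powR a t0.
  - apply: derivable_within_continuous => t tI.
    by apply: derivableN; apply: derivableM; [exact: derivable_cst|exact: dG].
  - exact/LR/dG.
  - move=> t /sub_oo/itv1 t1; rewrite derive1E.
    by have [_ ->] := is_derive1_powR_onem b t1.
(* If both integrals are infinite the two sides are +oo; if exactly one is, the hypothesis fails;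
   real arithmetic settles the finite case. *)
case: X X0 => [X| |]// X0; case: Y Y0 => [Y| |]// Y0;
  rewrite ?gt0_muley ?lte_fin// => -[].
by rewrite -!EFinM -!EFinD => H; congr EFin; move: H; lra.
Qed.

(** The integrand may blow up at 0 and 1, so parts are taken on compact intervals exhausting []0,
    1[]. The offset 3 keeps the cutoff below 1/2, hence the interval nondegenerate from n = 0 on. *)
Let inner (n : nat) : set R := [set` `[(n.+3%:R^-1 : R), 1 - n.+3%:R^-1]%R].

Let le_invSSS (t : R) : (0 < t)%R -> (((Num.truncn t^-1).+3%:R^-1 : R) <= t)%R.
Proof.
move=> t0; rewrite -[leRHS]invrK lef_pV2 ?posrE ?invr_gt0//.
apply: ltW; apply: (lt_le_trans (truncnS_gt _)).
by rewrite ler_nat ltnS leqW.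
Qed.

Let inner_nd m n : (m <= n)%N -> inner m `<=` inner n.
Proof.
move=> mn t; rewrite /inner /= !in_itv/= => /andP[tm mt].
have e : (n.+3%:R^-1 <= m.+3%:R^-1 :> R)%R by rewrite lef_pV2 ?posrE// ler_nat.
by rewrite (le_trans e)//= (le_trans mt)// lerB.
Qed.

Let inner_bigcup : [set` `]0%R, 1%R[ : interval R] = \bigcup_n inner n.
Proof.
apply/seteqP; split=> [t /=|t [n _]]; rewrite /inner /= !in_itv/= => /andP[t0 t1].
  have s0 : (0 < 1 - t)%R by rewrite subr_gt0.
  pose m := Num.truncn t^-1; pose k := Num.truncn (1 - t)^-1.
  exists (maxn m k) => //; rewrite /inner /= in_itv/=; apply/andP; split.
    by apply: le_trans (le_invSSS t0); rewrite lef_pV2 ?posrE// ler_nat !ltnS leq_maxl.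
  rewrite lerBrDl addrC -lerBrDl.
  by apply: le_trans (le_invSSS s0); rewrite lef_pV2 ?posrE// ler_nat !ltnS leq_maxr.
have e : (0 < n.+3%:R^-1 :> R)%R by rewrite invr_gt0.
by rewrite (lt_le_trans e)//= (le_lt_trans t1)// gtrBl.
Qed.

Let Beta_cvg a b :
  \int[mu]_(t in inner n) (t `^ (a - 1) * (1 - t) `^ (b - 1))%:E @[n --> \oo]
    --> Beta a b.
Proof.
rewrite /Beta inner_bigcup; apply: ge0_nondecreasing_set_cvg_integral => //.
- by move=> m n mn; apply/subsetPset; exact: inner_nd.
- by move=> n; exact: measurable_itv.
- by move=> n; apply/measurable_EFinP; exact: measurable_powR_mul.
- by move=> n t _; rewrite lee_fin mulr_ge0// powR_ge0.
Qed.

Lemma Beta_by_parts a b : (0 < a)%R -> (0 < b)%R ->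
  a%:E * Beta a (b + 1) = b%:E * Beta (a + 1) b.
Proof.
move=> a0 b0.
have shift_cvg c (u : R^nat) : (0 <= c)%R -> (u n @[n --> \oo] --> 0%R)%classic ->
    forall a' b', (fun n => c%:E * \int[mu]_(t in inner n)
      (t `^ (a' - 1) * (1 - t) `^ (b' - 1))%:E + (u n)%:E) @ \oo --> c%:E * Beta a' b'.
  move=> c0 u0 a' b'; rewrite -[X in _ --> X]adde0; apply: cvgeD.
  - exact: fin_num_adde_defl.
  - by apply: cvgeZl => //; exact: Beta_cvg.
  - by apply/cvg_EFin => //; exact: nearW.
have := shift_cvg a _ (ltW a0) (cvg_powR_mul a0 b0) a (b + 1)%R.
have := shift_cvg b _ (ltW b0) (cvg_powR_mul b0 a0) (a + 1)%R b.
move=> /cvg_lim <-// /cvg_lim <-//.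
congr (lim (_ @ \oo)); apply/funext => n.
have n0 : (0 < n.+3%:R^-1 :> R)%R by rewrite invr_gt0.
have n3 : (n.+3%:R^-1 < 2^-1 :> R)%R by rewrite ltf_pV2 ?posrE// ltr_nat.
move: n0 n3; rewrite /inner; move: (n.+3%:R^-1)%R => e n0 n3.
rewrite Beta_by_parts_itv//; [|lra|lra].
congr (_ + _%:E); rewrite mulrC; congr (_ `^ _ * _)%R; ring.
Qed.

(** By [BetaD] and [Beta_by_parts], a B(a, b) = a B(a + 1, b) + a B(a, b + 1) = a B(a + 1, b) + b
    B(a + 1, b). *)
Lemma Beta_Sl a b : (0 < a)%R -> (0 < b)%R ->
  (a + b)%:E * Beta (a + 1) b = a%:E * Beta a b.
Proof.
move=> a0 b0; rewrite [in RHS]BetaD//.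
move: (Beta_by_parts a0 b0) (Beta_ge0 (a + 1) b) (Beta_ge0 a (b + 1)).
move: (Beta (a + 1) b) (Beta a (b + 1)) => X Y XY X0 Y0.
by rewrite ge0_muleDr// XY EFinD ge0_muleDl// lee_fin ltW.
Qed.

Lemma Beta_Sr a b : (0 < a)%R -> (0 < b)%R ->
  (a + b)%:E * Beta a (b + 1) = b%:E * Beta a b.
Proof.
move=> a0 b0; rewrite [in RHS]BetaD//.
move: (Beta_by_parts a0 b0) (Beta_ge0 (a + 1) b) (Beta_ge0 a (b + 1)).
move: (Beta (a + 1) b) (Beta a (b + 1)) => X Y XY X0 Y0.
by rewrite ge0_muleDr// -XY EFinD ge0_muleDl// lee_fin ltW.
Qed.

End beta.

Section dirichlet_integral.
Context (R : realType).
Local Notation mu := (@lebesgue_measure R).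
Implicit Types (a b c t : R).

(* The library sets [t `^ r = 1] for t < 0, so each factor of the Dirichlet
   density carries its own restriction to t >= 0. *)
Definition ppow a t : R := if 0 <= t then t `^ (a - 1) else 0.

Lemma ppow_ge0 a t : 0 <= ppow a t.
Proof. by rewrite /ppow; case: ifP => // _; exact: powR_ge0. Qed.

Lemma ppow_lt0 a t : t < 0 -> ppow a t = 0.
Proof. by rewrite /ppow leNgt => ->. Qed.

Lemma ppow_gt0 a t : 0 < t -> ppow a t = t `^ (a - 1).
Proof. by move=> /ltW t0; rewrite /ppow t0. Qed.

Lemma measurable_ppow a : measurable_fun setT (ppow a).
Proof.
apply: measurable_fun_if => //.
- exact: measurable_fun_ler.
- by apply: measurable_funTS; exact: measurable_powR.
Qed.

Lemma mulr_ppow a t : 0 < a -> t * ppow a t = ppow (a + 1) t.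
Proof.
move=> a0; rewrite /ppow; case: ifPn => [t0|_]; last by rewrite mulr0.
by rewrite mulr_powRB1// addrK.
Qed.

(** [simplex_point] with total c in place of 1: once the first coordinate is fixed to t, the others
    form a simplex of total c - t, which the induction on n has to cover. *)
Definition last_coord n c (x : n.-tuple R) : n.+1.-tuple R :=
  [tuple of rcons x (c - \sum_i tnth x i)].

Definition dirichlet_kernel n (al : 'I_n.+1 -> R) c (x : n.-tuple R) : R :=
  \prod_i ppow (al i) (tnth (last_coord c x) i).

Lemma dirichlet_kernel_ge0 n (al : 'I_n.+1 -> R) c x : 0 <= dirichlet_kernel al c x.
Proof. by apply: prodr_ge0 => i _; exact: ppow_ge0. Qed.

Lemma last_coord_cons n c t (x : n.-tuple R) :
  last_coord c [tuple of t :: x] = [tuple of t :: last_coord (c - t) x].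
Proof.
apply/val_inj => /=; congr (_ :: rcons _ _).
rewrite big_ord_recl tnth0 opprD addrA; congr (_ - _).
by apply: eq_bigr => i _; rewrite tnthS.
Qed.

Lemma dirichlet_kernel_cons n (al : 'I_n.+2 -> R) c t (x : n.-tuple R) :
  dirichlet_kernel al c [tuple of t :: x] =
  ppow (al ord0) t * dirichlet_kernel (al \o lift ord0) (c - t) x.
Proof.
rewrite /dirichlet_kernel big_ord_recl last_coord_cons tnth0; congr (_ * _).
by apply: eq_bigr => i _; rewrite tnthS.
Qed.

Lemma measurable_last_coord n c : measurable_fun setT (@last_coord n c).
Proof.
apply/measurable_fun_tnthP => i.
have [iln|nli] := ltnP i n.
  rewrite (_ : _ \o _ = fun x => tnth x (Ordinal iln)); first exact: measurable_tnth.
  apply/funext => x /=; rewrite !(tnth_nth 0)/= nth_rcons size_tuple iln//.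
rewrite (_ : _ \o _ = fun x : n.-tuple R => c - \sum_i tnth x i).
  apply: measurable_funB => //.
  by apply: measurable_sum => j; exact: measurable_tnth.
apply/funext => x /=; rewrite (tnth_nth 0)/= nth_rcons size_tuple ltnNge nli/=.
by rewrite (_ : val i == n)//= eqn_leq nli -ltnS ltn_ord.
Qed.

Lemma measurable_dirichlet_kernel n (al : 'I_n.+1 -> R) c :
  measurable_fun setT (dirichlet_kernel al c).
Proof.
apply: measurable_prod => i _.
apply: (measurableT_comp (measurable_ppow _)).
apply: (measurableT_comp (@measurable_tnth _ _ _ i)); exact: measurable_last_coord.
Qed.

(** The multivariate Beta function, classically the product of the Gamma(al_i) over Gamma of their
    sum, written as the telescoping product that stick-breaking produces. *)
Fixpoint beta_prod n : ('I_n.+1 -> R) -> \bar R :=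
  match n with
  | 0 => fun=> 1%E
  | m.+1 => fun al => (Beta (al ord0) (\sum_(i < m.+1) al (lift ord0 i)) *
                       beta_prod (al \o lift ord0))%E
  end.

Lemma beta_prod_ge0 n (al : 'I_n.+1 -> R) : (0 <= beta_prod al)%E.
Proof. by elim: n al => //= n IH al; rewrite mule_ge0 ?Beta_ge0. Qed.

Local Open Scope ereal_scope.

(** Substitute c t for t: the powers contribute (a - 1) + (b - 1) to the exponent of c, and the
    Jacobian the remaining 1. *)
Lemma Beta_scale a b c : (0 < c)%R ->
  \int[mu]_(t in `]0%R, c[) (t `^ (a - 1) * (c - t) `^ (b - 1))%:E =
  (c `^ (a + b - 1))%:E * Beta a b.
Proof.
move=> c0.
pose f b' c' t := (t `^ (a - 1) * (c' - t) `^ (b' - 1))%:E.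
pose g c' := f b c' \_ [set` `]0%R, c'[%R].
have mg c' : measurable_fun [set: measurableTypeR R] (g c').
  apply/(measurable_restrictT _ _).1 => //.
  by apply/measurable_EFinP; exact: measurable_powR_mul.
have g0 c' t : 0 <= g c' t.
  by apply: erestrict_ge0 => {}t _; rewrite lee_fin mulr_ge0// powR_ge0.
have mc : measurable_fun [set: measurableTypeR R] ( *%R c : _ -> measurableTypeR R).
  exact: measurable_funM.
transitivity (\int[mu]_t g c t); first by rewrite [LHS]integral_mkcond.
rewrite (ge0_integral_scale c0 (mg c) (g0 c)).
have -> : Beta a b = \int[mu]_t g 1%R t by rewrite /Beta [LHS]integral_mkcond.
have cE : 0 <= c%:E by rewrite lee_fin ltW.
have pE : 0 <= (c `^ (a + b - 1))%:E by rewrite lee_fin powR_ge0.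
rewrite -(ge0_integralZl mu measurableT (measurableT_comp (mg c) mc) (fun t _ => g0 c _) cE).
rewrite -(ge0_integralZl mu measurableT (mg 1%R) (fun t _ => g0 1%R _) pE).
apply: eq_integral => t _; rewrite /= /g !patchE !mem_setE !in_itv/= pmulr_rgt0//.
have -> : (c * t < c)%R = (t < 1)%R by rewrite -[X in (_ < X)%R]mulr1 ltr_pM2l.
case: ifPn => [/andP[t0 t1]|_]; last by rewrite !mule0.
rewrite /f -!EFinM; congr EFin.
have s0 : (0 < 1 - t)%R by rewrite subr_gt0.
rewrite -[X in ((X - _) `^ _)%R]mulr1 -mulrBr !powRM ?ltW//.
have -> : (a + b - 1 = 1 + (a - 1) + (b - 1))%R by ring.
move: (a - 1)%R (b - 1)%R => p q.
rewrite !powRD ?(gt_eqF c0) ?implybT// powRr1 ?ltW//.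
by ring.
Qed.

(** A negative total forces a negative coordinate, where [ppow] vanishes. This confines the outer
    integral over the whole line to t <= c. *)
Lemma integral_dirichlet_kernel_lt0 n (al : 'I_n.+1 -> R) c :
  (c < 0)%R -> integral_Rn (fun x => (dirichlet_kernel al c x)%:E) = 0.
Proof.
elim: n al c => [|n IH] al c c0 /=.
  rewrite /dirichlet_kernel big_ord_recl big_ord0 mulr1 /=.
  by rewrite (tnth_nth 0%R)/= big_ord0 subr0 ppow_lt0.
apply: integral0_eq => t _.
under eq_fun do rewrite dirichlet_kernel_cons EFinM.
rewrite integral_Rn_ZL//; last 3 first.
- by apply/measurable_EFinP; exact: measurable_dirichlet_kernel.
- by move=> x; rewrite lee_fin dirichlet_kernel_ge0.
- exact: ppow_ge0.
have [t0|t0] := ltP t 0%R; first by rewrite ppow_lt0// mul0e.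
by rewrite IH ?mule0// subr_lt0 (lt_le_trans c0).
Qed.

Lemma integral_dirichlet_kernel n (al : 'I_n.+1 -> R) c :
  (forall i, (0 < al i)%R) -> (0 < c)%R ->
  integral_Rn (fun x => (dirichlet_kernel al c x)%:E) =
  (c `^ (\sum_i al i - 1))%:E * beta_prod al.
Proof.
elim: n al c => [|n IH] al c al0 c0 /=.
  rewrite /dirichlet_kernel !big_ord_recl !big_ord0 mulr1 mule1 addr0/=.
  by rewrite (tnth_nth 0%R)/= big_ord0 subr0 ppow_gt0.
pose A := (\sum_(i < n.+1) al (lift ord0 i))%R.
have A0 : (0 < A)%R by rewrite /A big_ord_recl ltr_pwDl// sumr_ge0// => i _; exact: ltW.
pose g t : \bar R := integral_Rn (fun y => (dirichlet_kernel al c [tuple of t :: y])%:E).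
have gE t : g t = (ppow (al ord0) t)%:E *
    integral_Rn (fun y => (dirichlet_kernel (al \o lift ord0) (c - t) y)%:E).
  rewrite /g; under eq_fun do rewrite dirichlet_kernel_cons EFinM.
  rewrite integral_Rn_ZL//.
  - by apply/measurable_EFinP; exact: measurable_dirichlet_kernel.
  - by move=> x; rewrite lee_fin dirichlet_kernel_ge0.
  - exact: ppow_ge0.
have mg : measurable_fun setT g.
  apply: (@measurable_integral_Rn_cons R n (fun u => (dirichlet_kernel al c u)%:E)).
    by apply/measurable_EFinP; exact: measurable_dirichlet_kernel.
  by move=> x; rewrite lee_fin dirichlet_kernel_ge0.
have ge0 t : 0 <= g t.
  by apply: integral_Rn_ge0 => x; rewrite lee_fin dirichlet_kernel_ge0.
have gout t : ~~ (t \in `[0%R, c]) -> g t = 0.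
  rewrite gE in_itv/= negb_and -!ltNge => /orP[t0|ct].
    by rewrite ppow_lt0// mul0e.
  by rewrite integral_dirichlet_kernel_lt0 ?mule0// subr_lt0.
transitivity (\int[mu]_(t in [set` `[0%R, c] : interval R]) g t).
  rewrite [RHS]integral_mkcond; apply: eq_integral => t _; rewrite patchE mem_setE.
  by case: ifPn => // /gout.
(* The endpoints are dropped as a null set: at t = c the remaining total is 0, which falls under
   neither the induction hypothesis nor the negative case. *)
rewrite integral_itv_bndoo; last exact: measurable_funTS.
transitivity (\int[mu]_(t in `]0%R, c[)
    (beta_prod (al \o lift ord0) * (t `^ (al ord0 - 1) * (c - t) `^ (A - 1))%:E)).
  apply: eq_integral => t; rewrite mem_setE in_itv/= => /andP[t0 tc].
  have ct : (0 < c - t)%R by rewrite subr_gt0.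
  rewrite gE (IH _ _ _ ct); last by move=> i; exact: al0.
  by rewrite ppow_gt0// EFinM muleA muleC.
rewrite ge0_integralZl//; last 3 first.
- by apply/measurable_EFinP; exact: measurable_powR_mul.
- by move=> t _; rewrite lee_fin mulr_ge0// powR_ge0.
- exact: beta_prod_ge0.
by rewrite Beta_scale// [in RHS]big_ord_recl -/A muleCA (muleC (beta_prod _)).
Qed.

Definition incr n (al : 'I_n -> R) (i : 'I_n) : 'I_n -> R :=
  fun j => (al j + (j == i)%:R)%R.

Lemma sum_incr n (al : 'I_n -> R) i : (\sum_j incr al i j = \sum_j al j + 1)%R.
Proof.
rewrite big_split /=; congr (_ + _)%R.
by rewrite (bigD1 i)//= eqxx big1 ?addr0// => j /negbTE ->.
Qed.

Lemma incr_gt0 n (al : 'I_n -> R) i : (forall j, (0 < al j)%R) ->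
  forall j, (0 < incr al i j)%R.
Proof. by move=> al0 j; rewrite ltr_pwDl. Qed.

(** Plays the role of Gamma(a + 1) = a Gamma(a). If i comes first, only the leading Beta factor
    changes, by [Beta_Sl]; otherwise [Beta_Sr] on that factor yields the sum A of the remaining
    parameters, exactly what the induction hypothesis consumes. *)
Lemma beta_prod_incr n (al : 'I_n.+1 -> R) i : (forall j, (0 < al j)%R) ->
  (\sum_j al j)%:E * beta_prod (incr al i) = (al i)%:E * beta_prod al.
Proof.
elim: n al i => [|n IH] al i al0.
  by rewrite big_ord1 /= (ord1 i).
rewrite big_ord_recl /=; set A := (\sum_(j < n.+1) al (lift ord0 j))%R.
have A0 : (0 < A)%R by rewrite /A big_ord_recl ltr_pwDl// sumr_ge0// => j _; exact: ltW.
have [->|[j ->]] : i = ord0 \/ exists j, i = lift ord0 j.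
  by case: (unliftP ord0 i) => [j ->|->]; [right; exists j|left].
- have -> : incr al ord0 \o lift ord0 = al \o lift ord0.
    by apply/funext => j; rewrite /incr /= addr0.
  have -> : (\sum_(j < n.+1) incr al ord0 (lift ord0 j) = A)%R.
    by apply: eq_bigr => j _; rewrite /incr /= addr0.
  by rewrite {1}/incr eqxx !muleA Beta_Sl.
- have -> : incr al (lift ord0 j) \o lift ord0 = incr (al \o lift ord0) j.
    by apply/funext => l; rewrite /incr /= (inj_eq lift_inj).
  have -> : (\sum_(l < n.+1) incr al (lift ord0 j) (lift ord0 l) = A + 1)%R.
    rewrite -(sum_incr (al \o lift ord0) j); apply: eq_bigr => l _.
    by rewrite /incr /= (inj_eq lift_inj).
  rewrite {1}/incr /= addr0 muleA Beta_Sr//.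
  rewrite [A%:E * _]muleC -muleA IH//.
  by rewrite muleCA.
Qed.

End dirichlet_integral.

(** * Moments of the Dirichlet law and of the observations *)

Section dirichlet_moments.
Context (R : realType) (n : nat).
Implicit Types (al : 'I_n.+1 -> R).

Lemma sum_simplex_point (x : n.-tuple R) : \sum_i tnth (simplex_point x) i = 1.
Proof.
rewrite big_ord_recr /= (tnth_nth 0) /= nth_rcons size_tuple ltnn eqxx.
rewrite (eq_bigr (tnth x)) ?subrKC//.
by move=> i _; rewrite !(tnth_nth 0) /= nth_rcons size_tuple ltn_ord.
Qed.

Lemma measurable_simplex : measurable (@simplex R n.+1).
Proof.
rewrite (_ : @simplex R n.+1 =
  (\bigcap_(i in [set: 'I_n.+1]) ((fun p => tnth p i) @^-1` `[0, +oo[%classic)) `&`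
  ((fun p => \sum_i tnth p i) @^-1` [set 1])).
  apply: measurableI.
    apply: fin_bigcap_measurable => // i _.
    rewrite -[X in measurable X]setTI; apply: measurable_tnth => //.
  rewrite -[X in measurable X]setTI.
  have mf : measurable_fun setT (fun p : n.+1.-tuple R => \sum_i tnth p i).
    by apply: measurable_sum => i; exact: measurable_tnth.
  exact: mf.
apply/seteqP; split => p /= -[p0 p1]; split => // i.
  by move=> _ /=; rewrite in_itv/= andbT.
by have := p0 i I; rewrite /= in_itv/= andbT.
Qed.

Lemma Gamma_ge0 (a : R) : 0 <= Gamma a.
Proof.
by apply: Rintegral_ge0 => t _; rewrite mulr_ge0 ?powR_ge0 ?expR_ge0.
Qed.

Definition dirichlet_const al : R := Gamma (\sum_i al i) / \prod_i Gamma (al i).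

Lemma dirichlet_const_ge0 al : 0 <= dirichlet_const al.
Proof. by rewrite divr_ge0 ?Gamma_ge0// prodr_ge0// => i _; exact: Gamma_ge0. Qed.

(** The coordinates of [simplex_point x] always sum to 1, so such a point is off the simplex only
    through a negative coordinate, and there [ppow] makes the kernel vanish. *)
Lemma dirichlet_densityE al (x : n.-tuple R) :
  \1_(@simplex R n.+1) (simplex_point x) * dirichlet_density al (simplex_point x) =
  dirichlet_const al * dirichlet_kernel al 1 x.
Proof.
rewrite /dirichlet_density -/(dirichlet_const al) mulrCA; congr (_ * _).
rewrite /dirichlet_kernel -[last_coord 1 x]/(simplex_point x).
have [/existsP[i xi]|] := boolP [exists i, tnth (simplex_point x) i < 0].
  rewrite [RHS](bigD1 i)//= ppow_lt0// mul0r indicE memNset ?mul0r//.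
  by move=> -[/(_ i)]; rewrite leNgt xi.
rewrite negb_exists => /forallP x0.
rewrite indicE mem_set ?mul1r; last first.
  by split=> [i|]; [rewrite leNgt x0|exact: sum_simplex_point].
by apply: eq_bigr => i _; rewrite /ppow leNgt x0.
Qed.

Lemma dirichlet_kernel_incr al i (x : n.-tuple R) : 0 < al i ->
  tnth (simplex_point x) i * dirichlet_kernel al 1 x = dirichlet_kernel (incr al i) 1 x.
Proof.
move=> ai0; rewrite /dirichlet_kernel (bigD1 i)//= [RHS](bigD1 i)//= mulrA.
congr (_ * _); first by rewrite mulr_ppow// /incr eqxx.
by apply: eq_bigr => j /negbTE ji; rewrite /incr ji addr0.
Qed.

Context (dO : measure_display) (Omega : measurableType dO) (P : probability Omega R)
  (h : {RV P >-> n.+1.-tuple R}).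
Variable al : 'I_n.+1 -> R.
Hypothesis al0 : forall i, 0 < al i.
Hypothesis hal : dirichlet_distributed al h.
Let C := dirichlet_const al.
Let A := \sum_i al i.

Lemma distribution_dirichletE B : measurable B ->
  distribution P h B = integral_Rn (fun x : n.-tuple R =>
     (\1_B (simplex_point x) * (C * dirichlet_kernel al 1 x))%:E).
Proof.
move=> mB; rewrite hal//; congr integral_Rn; apply/funext => x; congr EFin.
by rewrite -dirichlet_densityE mulrA indicI.
Qed.

Let S := h @^-1` @simplex R n.+1.

(** Monomials in h are known to be nonnegative only where h lies in the simplex, hence the integral
    over S; [probability_simplex] shows that S carries all the mass. *)
Lemma integral_simplex (f : n.+1.-tuple R -> R) : measurable_fun setT f ->
  (forall y, simplex y -> 0 <= f y) ->
  (\int[P]_(w in S) (f (h w))%:E)%E = integral_Rn (fun x : n.-tuple R =>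
     (f (simplex_point x) * (C * dirichlet_kernel al 1 x))%:E).
Proof.
move=> mf f0; pose g y := \1_(@simplex R n.+1) y * f y.
have mg : measurable_fun setT g.
  by apply: measurable_funM => //; apply: measurable_indic; exact: measurable_simplex.
have g0 y : 0 <= g y.
  rewrite /g indicE; have [/set_mem /f0 fy|] := boolP (y \in _); last by rewrite mul0r.
  by rewrite mul1r.
transitivity (\int[P]_w (g (h w))%:E)%E.
  rewrite integral_mkcond; apply: eq_integral => w _; rewrite patchE /g indicE.
  have -> : (w \in S) = (h w \in @simplex R n.+1).
    by apply/idP/idP => /set_mem ?; exact/mem_set.
  by case: ifPn; rewrite ?mul1r ?mul0r.
transitivity (\int[distribution P h]_y (g y)%:E)%E.
  apply/esym/(@ge0_integral_distribution _ _ _ _ _ _ h (EFin \o g)).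
    exact/measurable_EFinP.
  by move=> y; rewrite lee_fin.
rewrite (@integral_density_Rn R n _ _ _ (@simplex_point R n)
  (fun x => C * dirichlet_kernel al 1 x) g)//.
- congr integral_Rn; apply/funext => x; congr EFin; rewrite /g -dirichlet_densityE.
  by rewrite indicE; case: (_ \in _); rewrite ?mul0r ?mul1r ?mulr0.
- exact: measurable_last_coord.
- by apply: measurable_funM => //; exact: measurable_dirichlet_kernel.
- by move=> x; rewrite mulr_ge0 ?dirichlet_const_ge0 ?dirichlet_kernel_ge0.
- exact: distribution_dirichletE.
Qed.

Lemma integral_dirichlet_kernel1 be : (forall i, 0 < be i) ->
  integral_Rn (fun x : n.-tuple R => (C * dirichlet_kernel be 1 x)%:E) =
  (C%:E * beta_prod be)%E.
Proof.
move=> be0; under eq_fun do rewrite EFinM.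
rewrite integral_Rn_ZL.
- by rewrite integral_dirichlet_kernel// powR1 mul1e.
- by apply/measurable_EFinP; exact: measurable_dirichlet_kernel.
- by move=> x; rewrite lee_fin dirichlet_kernel_ge0.
- exact: dirichlet_const_ge0.
Qed.

Lemma dirichlet_normalization : (C%:E * beta_prod al)%E = 1%E.
Proof.
have <- : distribution P h setT = 1%E by exact: probability_setT.
rewrite distribution_dirichletE// -integral_dirichlet_kernel1//.
by congr integral_Rn; apply/funext => x; rewrite indicT mul1r.
Qed.

Lemma probability_simplex : P S = 1%E.
Proof.
rewrite -[P S]/(distribution P h (@simplex R n.+1)).
rewrite distribution_dirichletE; last exact: measurable_simplex.
rewrite -dirichlet_normalization -integral_dirichlet_kernel1//.
congr integral_Rn; apply/funext => x; rewrite -dirichlet_densityE mulrA.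
by congr (_ * _)%:E; rewrite indicE; case: (_ \in _); rewrite ?mul0r ?mul1r.
Qed.

(** The moment E[h_i h_j h_l]. Each coordinate shifts the parameter by [incr]: the numerator
    collects the entries met in [al], [incr al i] and [incr (incr al i) j], the denominator the
    three sums. *)
Definition dirichlet_moment3 i j l : R :=
  al i * (al j + (j == i)%:R) * (al l + (l == i)%:R + (l == j)%:R) /
  (A * (A + 1) * (A + 2)).

Lemma integral_dirichlet_moment3 i j l :
  (\int[P]_(w in S) (tnth (h w) i * tnth (h w) j * tnth (h w) l)%:E)%E =
  (dirichlet_moment3 i j l)%:E.
Proof.
have A0 : 0 < A by rewrite /A big_ord_recl ltr_pwDl// sumr_ge0// => m _; exact: ltW.
rewrite (integral_simplex (f := fun y => tnth y i * tnth y j * tnth y l)); last 2 first.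
- by apply: measurable_funM; [apply: measurable_funM|]; exact: measurable_tnth.
- by move=> y [y0 _]; rewrite !mulr_ge0.
have ai0 := incr_gt0 i al0; have aij0 := incr_gt0 j ai0.
have aijl0 := incr_gt0 l aij0.
transitivity (C%:E * beta_prod (incr (incr (incr al i) j) l))%E.
  rewrite -integral_dirichlet_kernel1//; congr integral_Rn; apply/funext => x.
  by rewrite -!dirichlet_kernel_incr//; congr EFin; ring.
move: (beta_prod_incr i al0) (beta_prod_incr j ai0) (beta_prod_incr l aij0).
move: (dirichlet_normalization) (beta_prod_ge0 al).
rewrite !sum_incr -/A.
move: (beta_prod al) (beta_prod (incr al i)) (beta_prod (incr (incr al i) j))
  (beta_prod (incr (incr (incr al i) j) l)) => b0 b1 b2 b3.
have C0 : 0 <= C by exact: dirichlet_const_ge0.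
have A1 : 0 < A + 1 by exact: addr_gt0.
have A2 : 0 < A + 1 + 1 by exact: addr_gt0.
(* Since C b0 = 1, an infinite b0 is impossible, whether C = 0 or C > 0. The three recurrences then
   make b1, b2 and b3 finite in turn. *)
case: b0 => [b0| |]//; last first.
  have [CE|Cn0] := eqVneq 0 C.
    by rewrite -CE mul0e => -[/esym/eqP]; rewrite oner_eq0.
  have C1 : (0 < C%:E)%E by rewrite lte_fin lt_def eq_sym Cn0.
  by rewrite gt0_muley.
move=> [Cb0] _.
case: b1 => [b1| |]; rewrite ?gt0_muley ?gt0_muleNy ?lte_fin// => -[b1E].
case: b2 => [b2| |]; rewrite ?gt0_muley ?gt0_muleNy ?lte_fin// => -[b2E].
have A2E : (0 < (A + 1 + 1)%:E)%E by rewrite lte_fin.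
case: b3 => [b3 [b3E]||]; [|by rewrite (gt0_muley A2E)|by rewrite (gt0_muleNy A2E)].
rewrite -EFinM; congr EFin; rewrite /dirichlet_moment3.
have A20 : A + 2 = A + 1 + 1 by ring.
apply: (canRL (mulfK _)); first by rewrite A20 !mulf_neq0 ?gt_eqF.
rewrite (_ : C * b3 * (A * (A + 1) * (A + 2)) =
  C * A * (A + 1) * ((A + 1 + 1) * b3)); last by ring.
rewrite b3E (_ : _ * _ = C * A * incr (incr al i) j l * ((A + 1) * b2)); last by ring.
rewrite b2E (_ : _ * _ = C * incr al i j * incr (incr al i) j l * (A * b1)); last by ring.
rewrite b1E (_ : _ * _ = (C * b0) * (al i * incr al i j * incr (incr al i) j l)); last by ring.
by rewrite Cb0 mul1r.
Qed.

End dirichlet_moments.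

(** * Expectations of functions of finitely many topics and outcomes *)

Section finite_expectation.
Context (R : realType) (dO : measure_display) (Omega : measurableType dO)
  (P : probability Omega R) (I : finType) (Y : Omega -> I) (p : I -> R).
Hypothesis mY : forall i, measurable [set w | Y w = i].
Hypothesis pE : forall i, P [set w | Y w = i] = (p i)%:E.

Lemma expectation_finite (f : I -> R) :
  ('E_P[fun w => f (Y w)] = (\sum_i f i * p i)%:E)%E.
Proof.
rewrite unlock.
transitivity (\int[P]_w (\sum_i (f i)%:E * (\1_[set w | Y w = i] w)%:E))%E.
  apply: eq_integral => w _; rewrite (bigD1 (Y w))//= big1.
    by rewrite adde0 indicE mem_set// mule1.
  by move=> i /eqP iY; rewrite indicE memNset ?mule0// => /esym.
rewrite integral_sum//; last first.
  by move=> i; apply: integrableZl => //; exact: integrable_indic.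
rewrite -sumEFin; apply: eq_bigr => i _.
rewrite integralZl//; last exact: integrable_indic.
by rewrite integral_indic// setIT EFinM -pE.
Qed.

End finite_expectation.

Section observation_moments.
Context (R : realType) (n d : nat) (al : 'I_n.+1 -> R) (O : 'M[R]_(d, n.+1))
  (dO : measure_display) (Omega : measurableType dO) (P : probability Omega R)
  (h : {RV P >-> n.+1.-tuple R})
  (z : nat -> Omega -> 'I_n.+1) (y : nat -> Omega -> 'I_d).
Hypothesis al0 : forall i, 0 < al i.
Hypothesis hal : dirichlet_distributed al h.
Hypothesis xh : lda_sampling O h z y.
Hypothesis O_topic : topic_matrix O.
Let T : finType := ('I_n.+1 * 'I_d)%type.
Let zy v w : T := (z v w, y v w).
Let S := h @^-1` @simplex R n.+1.
Let A := \sum_i al i.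

Let mzy v q : measurable [set w | zy v w = q].
Proof.
have [mz my _] := xh; case: q => i j.
rewrite (_ : [set w | _] = [set w | z v w = i] `&` [set w | y v w = j]).
  exact: measurableI.
by apply/seteqP; split=> w; rewrite /zy /= => -[-> ->].
Qed.

Let mS : measurable S.
Proof.
rewrite -[S]setTI; apply: (measurable_funP h) => //; exact: measurable_simplex.
Qed.

Let Y w : T * T * T := (zy 0%N w, zy 1%N w, zy 2%N w).

Let mY q : measurable [set w | Y w = q].
Proof.
case: q => [[q0 q1] q2].
rewrite (_ : [set w | _] = [set w | zy 0%N w = q0] `&` [set w | zy 1%N w = q1] `&`
  [set w | zy 2%N w = q2]).
  by apply: measurableI => //; exact: measurableI.
by apply/seteqP; split => w; rewrite /Y /=; [move=> [<- <- <-]|move=> [[-> ->] ->]].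
Qed.

Let weight (q : T) : R := O q.2 q.1.

Lemma probability_triple (q : T * T * T) :
  P [set w | Y w = q] = (dirichlet_moment3 al q.1.1.1 q.1.2.1 q.2.1 *
    (weight q.1.1 * weight q.1.2 * weight q.2))%:E.
Proof.
have [_ _ xh3] := xh.
(* The complement of S is null, and [lda_sampling] with B the simplex then gives an integral over S,
   where the Dirichlet moments are available. *)
have -> : P [set w | Y w = q] = P (S `&` [set w | Y w = q]).
  apply/eqP; rewrite eq_le; apply/andP; split; last first.
    by apply: le_measure; rewrite ?in_setE//; exact: measurableI.
  rewrite (measureDI P (mY q) mS) [X in (X + _)%E](_ : _ = 0%E).
    by rewrite add0e setIC.
  apply/eqP; rewrite eq_le measure_ge0 andbT.
  have <- : P (~` S) = 0%E by rewrite probability_setC// (probability_simplex al0 hal) subee.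
  apply: le_measure; rewrite ?in_setE//;
    first [exact: measurableD|exact: measurableC|by move=> t []].
have := @xh3 3%N (tnth [tuple q.1.1.1; q.1.2.1; q.2.1]) (tnth [tuple q.1.1.2; q.1.2.2; q.2.2])
  _ (@measurable_simplex R n).
rewrite (_ : [set w | forall v : 'I_3, _] = [set w | Y w = q]); last first.
  apply/seteqP; split=> w /=.
    move=> Yw; case: q Yw => [[[i0 j0] [i1 j1]] [i2 j2]] Yw.
    move: (Yw ord0) (Yw (lift ord0 ord0)) (Yw (lift ord0 (lift ord0 ord0))).
    rewrite !tnthS !tnth0 /=.
    by rewrite /Y /zy => -[-> ->] [-> ->] [-> ->].
  move=> <- v; case: (unliftP ord0 v) => [{}v|] ->; last by rewrite !tnth0.
  rewrite !tnthS; case: (unliftP ord0 v) => [{}v|] ->; last by rewrite !tnth0.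
  by rewrite !tnthS (ord1 v) !tnth0.
move=> ->.
rewrite (eq_integral (fun w => ((weight q.1.1 * weight q.1.2 * weight q.2)%:E *
  (tnth (h w) q.1.1.1 * tnth (h w) q.1.2.1 * tnth (h w) q.2.1)%:E)%E)); last first.
  move=> w _; rewrite !big_ord_recl big_ord0 !tnthS !tnth0 -EFinM /weight.
  by congr EFin; ring.
rewrite ge0_integralZl//; last 3 first.
- apply: measurable_funTS; apply/measurable_EFinP.
  by apply: measurable_funM; [apply: measurable_funM|];
    apply: (measurableT_comp (@measurable_tnth _ _ _ _)); exact: measurable_funP.
- by move=> w [hw _]; rewrite lee_fin !mulr_ge0.
- by rewrite lee_fin !mulr_ge0// (O_topic.2 _).1.
by rewrite (integral_dirichlet_moment3 al0 hal) -EFinM mulrC.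
Qed.

(** The conditional mean of f at an outcome drawn from topic i. *)
Let wsum (f : 'I_d -> R) i := \sum_a f a * O a i.

Let sum_weight (phi : 'I_n.+1 -> R) f :
  \sum_(s : T) phi s.1 * (f s.2 * weight s) = \sum_i phi i * wsum f i.
Proof.
rewrite -(pair_bigA _ (fun i a => phi i * (f a * O a i))) /=.
by apply: eq_bigr => i _; rewrite mulr_sumr.
Qed.

(* The sums are nested so that constant factors yield the lower order moments as
   marginals of the third. *)
Lemma expectation_triple (f g k : 'I_d -> R) :
  fine ('E_P[(fun w => f (y 0%N w) * g (y 1%N w) * k (y 2%N w))%R])%E =
  \sum_i (\sum_j (\sum_l dirichlet_moment3 al i j l * wsum k l) * wsum g j) * wsum f i.
Proof.
rewrite (@expectation_finite R dO Omega P (T * T * T)%type Y _ mY probability_triple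
  (fun q => f q.1.1.2 * g q.1.2.2 * k q.2.2)) /=.
transitivity (\sum_(s : T) \sum_(t : T) \sum_(u : T)
   dirichlet_moment3 al s.1 t.1 u.1 * (k u.2 * weight u) *
     (g t.2 * weight t) * (f s.2 * weight s)).
  rewrite pair_bigA pair_bigA; apply: eq_bigr => -[[s t] u] _ /=; ring.
rewrite -(sum_weight (fun i =>
  \sum_j (\sum_l dirichlet_moment3 al i j l * wsum k l) * wsum g j)).
apply: eq_bigr => s _.
rewrite -(sum_weight (fun j => \sum_l dirichlet_moment3 al s.1 j l * wsum k l)) mulr_suml.
apply: eq_bigr => t _.
by rewrite -(sum_weight (dirichlet_moment3 al s.1 t.1)) !mulr_suml.
Qed.

Let A0 : 0 < A.
Proof. by rewrite /A big_ord_recl ltr_pwDl// sumr_ge0// => i _; exact: ltW. Qed.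

(** The entries of [al] sum to A and each Kronecker symbol to 1, so the sum over l produces A + 2,
    which cancels. *)
Lemma dirichlet_moment2 i j : \sum_l dirichlet_moment3 al i j l =
  al i * (al j + (j == i)%:R) / (A * (A + 1)).
Proof.
rewrite -mulr_suml -mulr_sumr !big_split /= -/A.
have delta (m : 'I_n.+1) : \sum_l ((l == m)%:R : R) = 1.
  by rewrite (bigD1 m)//= eqxx big1 ?addr0// => l /negbTE ->.
rewrite !delta; field.
by rewrite !gt_eqF ?addr_gt0.
Qed.

Lemma dirichlet_moment1 i :
  \sum_j al i * (al j + (j == i)%:R) / (A * (A + 1)) = al i / A.
Proof.
rewrite -mulr_suml -mulr_sumr big_split /= -/A.
rewrite [\sum_(j < _) (_ == _)%:R](_ : _ = 1); last first.
  by rewrite (bigD1 i)//= eqxx big1 ?addr0// => l /negbTE ->.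
by field; rewrite !gt_eqF ?addr_gt0.
Qed.

Let wsum1 i : wsum (fun=> 1) i = 1.
Proof. by rewrite /wsum; under eq_bigr do rewrite mul1r; exact: (O_topic.2 i).2. Qed.

Let wsum_delta a i : wsum (fun b => (b == a)%:R) i = O a i.
Proof.
rewrite /wsum (bigD1 a)//= eqxx mul1r big1 ?addr0// => b /negbTE ->.
by rewrite mul0r.
Qed.

Let x := observation R y.

Let obsE v w a (c : 'I_1) : x v w a c = (y v w == a)%:R.
Proof. by rewrite /x /observation (ord1 c) mxE eqxx andbT eq_sym. Qed.

Lemma first_momentE : first_moment P x = O *m \col_i (al i / A).
Proof.
apply/matrixP => a b; rewrite (ord1 b) mxE [RHS]mxE.
have <- : (fun w => (y 0%N w == a)%:R * 1 * 1) = (fun w => x 0%N w a 0).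
  by apply/funext => w; rewrite obsE !mulr1.
rewrite (expectation_triple (fun b => (b == a)%:R) (fun=> 1) (fun=> 1)).
apply: eq_bigr => i _; rewrite wsum_delta mulrC mxE; congr (_ * _).
rewrite -dirichlet_moment1; apply: eq_bigr => j _; rewrite wsum1 mulr1.
by rewrite -dirichlet_moment2; apply: eq_bigr => l _; rewrite wsum1 mulr1.
Qed.

Let M2 : 'M[R]_n.+1 := \matrix_(i, j) (al i * (al j + (j == i)%:R) / (A * (A + 1))).

Lemma second_momentE : second_moment P x = O *m M2 *m O^T.
Proof.
apply/matrixP => a b; rewrite mxE.
have <- : (fun w => (y 0%N w == a)%:R * (y 1%N w == b)%:R * 1) =
    (fun w => (x 0%N w *m (x 1%N w)^T) a b).
  by apply/funext => w; rewrite mxE big_ord1 [(_^T) _ _]mxE !obsE mulr1.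
rewrite (expectation_triple (fun c => (c == a)%:R) (fun c => (c == b)%:R) (fun=> 1)).
rewrite -mulmxA [RHS]mxE; apply: eq_bigr => i _.
rewrite wsum_delta mulrC [in RHS]mxE; congr (_ * _).
apply: eq_bigr => j _; rewrite wsum_delta !mxE; congr (_ * _).
by rewrite -dirichlet_moment2; apply: eq_bigr => l _; rewrite wsum1 mulr1.
Qed.

Let M3 (q : 'cV[R]_n.+1) : 'M[R]_n.+1 :=
  \matrix_(i, j) \sum_l dirichlet_moment3 al i j l * q l 0.

Lemma third_momentE (eta : 'cV[R]_d) :
  third_moment P x eta = O *m M3 (O^T *m eta) *m O^T.
Proof.
apply/matrixP => a b; rewrite mxE.
have dotE w : dotv eta (x 2%N w) = eta (y 2%N w) 0.
  rewrite /dotv mxE (bigD1 (y 2%N w))//= obsE eqxx mulr1 mxE big1 ?addr0// => c.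
  by rewrite obsE eq_sym => /negbTE ->; rewrite mulr0.
have <- : (fun w => (y 0%N w == a)%:R * (y 1%N w == b)%:R * eta (y 2%N w) 0) =
    (fun w => (dotv eta (x 2%N w) *: (x 0%N w *m (x 1%N w)^T)) a b).
  by apply/funext => w; rewrite mxE dotE [(_ *m _) _ _]mxE big_ord1 [(_^T) _ _]mxE !obsE mulrC.
rewrite (expectation_triple (fun c => (c == a)%:R) (fun c => (c == b)%:R) (fun c => eta c 0)).
rewrite -mulmxA [RHS]mxE; apply: eq_bigr => i _.
rewrite wsum_delta mulrC [in RHS]mxE; congr (_ * _).
apply: eq_bigr => j _; rewrite wsum_delta !mxE; congr (_ * _).
apply: eq_bigr => l _; rewrite mxE; congr (_ * _).
by rewrite /wsum; apply: eq_bigr => c _; rewrite mxE mulrC.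
Qed.

Let conjZ c (X : 'M[R]_n.+1) : c *: (O *m X *m O^T) = O *m (c *: X) *m O^T.
Proof. by rewrite scalemxAl scalemxAr. Qed.

Let conjD (X X' : 'M[R]_n.+1) : O *m X *m O^T + O *m X' *m O^T = O *m (X + X') *m O^T.
Proof. by rewrite mulmxDr mulmxDl. Qed.

Let conjB (X X' : 'M[R]_n.+1) : O *m X *m O^T - O *m X' *m O^T = O *m (X - X') *m O^T.
Proof. by rewrite mulmxBr mulmxBl. Qed.

(** Here E[h h^T] is (alpha alpha^T + diag(alpha)) / (A (A + 1)) and the outer square of E[h] is
    alpha alpha^T / A^2, so the weight A / (A + 1) removes exactly the rank-one part. *)
Lemma PairsE : Pairs P x A = O *m diag_mx (\row_i (al i / (A * (A + 1)))) *m O^T.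
Proof.
rewrite /Pairs first_momentE second_momentE; set m1 := \col_i (al i / A).
have -> : O *m m1 *m (O *m m1)^T = O *m (m1 *m m1^T) *m O^T.
  by rewrite trmx_mul !mulmxA.
rewrite conjZ conjB; congr (_ *m _ *m _).
apply/matrixP => i j; rewrite !mxE big_ord1 !mxE -mulr_natr eq_sym; field.
by rewrite !gt_eqF ?addr_gt0.
Qed.

(** With s the scalar product of alpha and q, and up to the factor 1 / (A (A + 1) (A + 2)), the
    coefficient of alpha_i alpha_j is (s + q_i + q_j) - (3 s + q_i + q_j) + 2 s = 0; the diagonal
    keeps alpha_i (s + 2 q_i) - alpha_i s. *)
Lemma TriplesE (eta : 'cV[R]_d) : Triples P x A eta =
  O *m diag_mx (\row_i (2 * al i * (O^T *m eta) i 0 / (A * (A + 1) * (A + 2)))) *m O^T.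
Proof.
rewrite /Triples first_momentE second_momentE third_momentE.
set q := O^T *m eta; set m1 := \col_i (al i / A).
have qT : eta^T *m O = q^T by rewrite /q trmx_mul trmxK.
have dotE : dotv eta (O *m m1) = dotv q m1 by rewrite /dotv mulmxA qT.
rewrite dotE trmx_mul.
have -> : O *m M2 *m O^T *m eta *m (m1^T *m O^T) = O *m (M2 *m q *m m1^T) *m O^T.
  by rewrite /q !mulmxA.
have -> : O *m m1 *m eta^T *m (O *m M2 *m O^T) = O *m (m1 *m q^T *m M2) *m O^T.
  by rewrite -qT !mulmxA.
have -> : O *m m1 *m (m1^T *m O^T) = O *m (m1 *m m1^T) *m O^T by rewrite !mulmxA.
rewrite conjZ !conjD conjZ conjB conjZ conjD; congr (_ *m _ *m _).
pose s := \sum_l al l * q l 0.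
have delta (u : 'I_n.+1) : \sum_l (l == u)%:R * q l 0 = q u 0.
  by rewrite (bigD1 u)//= eqxx mul1r big1 ?addr0// => l /negbTE ->; rewrite mul0r.
have M3E i j : M3 q i j = al i * (al j + (j == i)%:R) * (s + q i 0 + q j 0) /
    (A * (A + 1) * (A + 2)).
  rewrite mxE -(delta i) -(delta j) /s -!big_split/= mulr_sumr mulr_suml.
  by apply: eq_bigr => l _; rewrite /dirichlet_moment3 -/A; ring.
have M2q i : (M2 *m q) i 0 = al i * (s + q i 0) / (A * (A + 1)).
  rewrite mxE -(delta i) /s -!big_split/= mulr_sumr mulr_suml.
  by apply: eq_bigr => l _; rewrite mxE; ring.
have qM2 j : (q^T *m M2) 0 j = al j * (s + q j 0) / (A * (A + 1)).
  rewrite -M2q mxE [RHS]mxE; apply: eq_bigr => l _; rewrite !mxE eq_sym.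
  by have [->|_] := eqVneq l j; [ring|rewrite !addr0; ring].
have m1q : dotv q m1 = s / A.
  rewrite /dotv mxE /s mulr_suml; apply: eq_bigr => l _; rewrite !mxE; ring.
apply/matrixP => i j; rewrite m1q -(mulmxA m1).
have addE (X X' : 'M[R]_n.+1) : (X + X') i j = X i j + X' i j by rewrite mxE.
have subE (X X' : 'M[R]_n.+1) : (X - X') i j = X i j - X' i j by rewrite 2!mxE.
have scaleE c (X : 'M[R]_n.+1) : (c *: X) i j = c * X i j by rewrite mxE.
have outerE (u : 'cV[R]_n.+1) (v : 'rV[R]_n.+1) : (u *m v) i j = u i 0 * v 0 j.
  by rewrite mxE big_ord1.
rewrite addE subE !scaleE !addE scaleE !outerE M3E M2q qM2 !mxE (eq_sym i j).
have [->|_] := eqVneq j i.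
- rewrite !mulr1n; move: (\sum_j0 _) (al i) (s) (A) A0 => q' a s' A' A'0.
  by field; rewrite !gt_eqF ?addr_gt0.
- rewrite !mulr0n addr0; move: (\sum_j0 _) (al i) => q' a.
  move: (\sum_j0 _) (al j) (s) (A) A0 => q'' a' s' A' A'0.
  by field; rewrite !gt_eqF ?addr_gt0.
Qed.

End observation_moments.

(** * The uniform law on the sphere *)

Section dotv.
Context (R : realType).

Lemma dotvE n (u v : 'cV[R]_n) : dotv u v = \sum_i u i 0 * v i 0.
Proof. by rewrite /dotv mxE; apply: eq_bigr => i _; rewrite mxE. Qed.

Lemma dotvC n (u v : 'cV[R]_n) : dotv u v = dotv v u.
Proof. by rewrite !dotvE; apply: eq_bigr => i _; rewrite mulrC. Qed.

Lemma dotvDr n (u v w : 'cV[R]_n) : dotv u (v + w) = dotv u v + dotv u w.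
Proof. by rewrite /dotv mulmxDr mxE. Qed.

Lemma dotvZr n (u v : 'cV[R]_n) a : dotv u (a *: v) = a * dotv u v.
Proof. by rewrite /dotv -scalemxAr mxE. Qed.

Lemma dotvZl n (u v : 'cV[R]_n) a : dotv (a *: u) v = a * dotv u v.
Proof. by rewrite dotvC dotvZr dotvC. Qed.

Lemma dotvBr n (u v w : 'cV[R]_n) : dotv u (v - w) = dotv u v - dotv u w.
Proof. by rewrite -scaleN1r dotvDr dotvZr mulN1r. Qed.

Lemma dotvBl n (u v w : 'cV[R]_n) : dotv (u - v) w = dotv u w - dotv v w.
Proof. by rewrite dotvC dotvBr !(dotvC w). Qed.

Lemma dotv_ge0 n (u : 'cV[R]_n) : 0 <= dotv u u.
Proof. by rewrite dotvE sumr_ge0// => i _; rewrite -expr2 sqr_ge0. Qed.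

Lemma dotv_eq0 n (u : 'cV[R]_n) : (dotv u u == 0) = (u == 0).
Proof.
apply/idP/eqP => [|->]; last by rewrite /dotv mulmx0 mxE.
rewrite dotvE psumr_eq0; last by move=> i _; rewrite -expr2 sqr_ge0.
move=> /allP u0; apply/matrixP => i j; rewrite ord1 mxE.
by have := u0 i (mem_index_enum i); rewrite /= mulf_eq0 orbb => /eqP.
Qed.

Lemma dotv_gt0 n (u : 'cV[R]_n) : u != 0 -> 0 < dotv u u.
Proof. by move=> u0; rewrite lt_def dotv_eq0 u0 dotv_ge0. Qed.

Lemma dotv_mulmx m n (A : 'M[R]_(m, n)) u v : dotv u (A *m v) = dotv (A^T *m u) v.
Proof. by rewrite /dotv trmx_mul trmxK mulmxA. Qed.

Lemma mulmx_trmx_dotv n (u v : 'cV[R]_n) : u^T *m v = (dotv u v)%:M.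
Proof. by apply/matrixP => i j; rewrite !ord1 [RHS]mxE eqxx mulr1n. Qed.

Definition householder n (v : 'cV[R]_n) : 'M[R]_n :=
  1%:M - (2 / dotv v v) *: (v *m v^T).

Lemma trmx_householder n (v : 'cV[R]_n) : (householder v)^T = householder v.
Proof. by rewrite /householder raddfB /= linearZ /= trmx1 trmx_mul trmxK. Qed.

Lemma householderE n (v x : 'cV[R]_n) :
  householder v *m x = x - (2 * dotv v x / dotv v v) *: v.
Proof.
rewrite /householder mulmxBl mul1mx -scalemxAl -mulmxA mulmx_trmx_dotv.
by rewrite mul_mx_scalar scalerA; congr (_ - _ *: _); ring.
Qed.

Lemma householder_orthogonal n (v : 'cV[R]_n) :
  v != 0 -> (householder v)^T *m householder v = 1%:M.
Proof.
move=> v0; rewrite trmx_householder.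
have w0 : dotv v v != 0 by rewrite dotv_eq0.
rewrite {1}/householder mulmxBl mul1mx -scalemxAl.
have -> : v *m v^T *m householder v = - (v *m v^T).
  rewrite /householder mulmxBr mulmx1 -scalemxAr mulmxA -(mulmxA v v^T v).
  rewrite mulmx_trmx_dotv mul_mx_scalar -scalemxAl scalerA divfK//.
  by rewrite scaler_nat mulr2n opprD addrA subrr sub0r.
by rewrite scalerN opprK /householder subrK.
Qed.

(** The reflection along a - b exchanges two distinct vectors of equal length. *)
Lemma orthogonal_map n (a b : 'cV[R]_n) : dotv a a = dotv b b ->
  exists2 G : 'M[R]_n, G^T *m G = 1%:M & G *m a = b.
Proof.
move=> ab; have [->|nab] := eqVneq a b.
  by exists 1%:M; rewrite ?trmx1 mul1mx.
have v0 : a - b != 0 by rewrite subr_eq0.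
exists (householder (a - b)); first exact: householder_orthogonal.
have w0 : dotv (a - b) (a - b) != 0 by rewrite dotv_eq0.
rewrite householderE.
have -> : 2 * dotv (a - b) a = dotv (a - b) (a - b).
  by rewrite !dotvBl !dotvBr (dotvC b a) -ab; ring.
by rewrite divff// scale1r opprB addrC subrK.
Qed.

End dotv.

Section sphere.
Context (R : realType).

Lemma cV_of_tupleK n (v : 'cV[R]_n) : cV_of_tuple (tuple_of_cV v) = v.
Proof. by apply/matrixP => i j; rewrite ord1 mxE tnth_mktuple. Qed.

Lemma measurable_dotv n (a : 'cV[R]_n) :
  measurable_fun setT (fun t : n.-tuple R => dotv a (cV_of_tuple t)).
Proof.
under eq_fun do (rewrite dotvE; under eq_bigr do rewrite mxE).
apply: measurable_sum => i; apply: measurable_funM => //.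
exact: measurable_tnth.
Qed.

Definition hyperplane n (a : 'cV[R]_n) : set (n.-tuple R) :=
  [set t | dotv a (cV_of_tuple t) = 0].

Lemma measurable_hyperplane n (a : 'cV[R]_n) : measurable (hyperplane a).
Proof.
rewrite (_ : hyperplane a = (fun t => dotv a (cV_of_tuple t)) @^-1` [set 0])//.
rewrite -[X in measurable X]setTI; apply: measurable_dotv => //.
Qed.

Definition moment_curve n (t : R) : 'cV[R]_n := \col_i t ^+ i.

(** The scalar product with v is the value at t of the nonzero polynomial whose coefficients are the
    entries of v, so the count is bounded by its number of roots. *)
Lemma moment_curve_count n N (v : 'cV[R]_n) : v != 0 ->
  (\sum_(j < N) (dotv (moment_curve n j%:R) v == 0%R :> R) <= n)%N.
Proof.
case: n v => [v|n v v0]; first by rewrite [v]flatmx0 eqxx.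
pose p := \poly_(i < n.+1) v (inord i) 0.
have pE t : dotv (moment_curve n.+1 t) v = p.[t].
  rewrite horner_poly dotvE; apply: eq_bigr => i _.
  by rewrite mxE inord_val mulrC.
have p0 : p != 0.
  apply: contraNneq v0 => p0; apply/eqP/matrixP => i j; rewrite ord1 mxE.
  have := congr1 (fun q : {poly R} => q`_i) p0.
  by rewrite coef_poly ltn_ord inord_val coef0.
pose s := [seq x <- [seq j%:R | j <- iota 0 N] | root p x] : seq R.
have sp : (size s < size p)%N.
  apply: max_poly_roots => //; first exact: filter_all.
  rewrite filter_uniq// map_inj_uniq ?iota_uniq//.
  by move=> i j /eqP; rewrite eqr_nat => /eqP.
have <- : size s = (\sum_(j < N) (dotv (moment_curve n.+1 j%:R) v == 0%R :> R))%N.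
  rewrite size_filter count_map -sum1_count big_mkcond /=.
  rewrite -[N in iota _ N]subn0 -/(index_iota 0 N) big_mkord.
  by apply: eq_bigr => j _; rewrite pE /root; case: eqP.
exact/ltnW/(leq_trans sp)/size_poly.
Qed.

Lemma moment_curve_neq0 n t : moment_curve n.+1 t != 0.
Proof.
apply/eqP => /matrixP/(_ ord0 0); rewrite !mxE expr0.
by apply/eqP; exact: oner_neq0.
Qed.

Definition unit_sphere n : set (n.-tuple R) :=
  [set t | dotv (cV_of_tuple t) (cV_of_tuple t) = 1].

Lemma measurable_unit_sphere n : measurable (@unit_sphere n).
Proof.
rewrite (_ : @unit_sphere n =
  (fun t => dotv (cV_of_tuple t) (cV_of_tuple t)) @^-1` [set 1])//.
rewrite -[X in measurable X]setTI.
suff mf : measurable_fun setT (fun t : n.-tuple R => dotv (cV_of_tuple t) (cV_of_tuple t)).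
  exact: mf.
under eq_fun do (rewrite dotvE; under eq_bigr do rewrite !mxE).
by apply: measurable_sum => i; apply: measurable_funM; exact: measurable_tnth.
Qed.

Lemma hyperplane_scale n (a : 'cV[R]_n) c : c != 0 ->
  hyperplane (c *: a) = hyperplane a.
Proof.
move=> c0; apply/seteqP; split => t; rewrite /hyperplane /= dotvZl.
  by move/eqP; rewrite mulf_eq0 (negbTE c0) => /eqP.
by move=> ->; rewrite mulr0.
Qed.

(* All hyperplanes have the same measure m; N normals on the moment curve give
   N hyperplanes of which a nonzero point meets at most n, so N m <= n. *)
Lemma uniform_hyperplane0 n (dT : measure_display) (T : measurableType dT)
    (Q : probability T R) (theta : {RV Q >-> n.-tuple R}) (a : 'cV[R]_n) :
  uniform_on_sphere theta -> a != 0 -> distribution Q theta (hyperplane a) = 0%E.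
Proof.
pose mu : probability (n.-tuple R) R := distribution Q theta.
rewrite -[distribution Q theta]/(mu : set _ -> \bar R) => -[muS' inv] a0.
have muS : mu (@unit_sphere n) = 1%E by exact: muS'.
have mH b := @measurable_hyperplane n b.
have mS := @measurable_unit_sphere n.
have muSC : mu (~` @unit_sphere n) = 0%E.
  by rewrite probability_setC// muS subee.
(* Cutting with the sphere removes the origin, which lies on every hyperplane and would spoil the
   count. *)
have muHS b : mu (hyperplane b) = mu (hyperplane b `&` @unit_sphere n).
  apply/eqP; rewrite eq_le; apply/andP; split; last first.
    by apply: le_measure; rewrite ?in_setE//; exact: measurableI.
  rewrite (measureDI mu (mH b) mS) [X in (X + _)%E](_ : _ = 0%E) ?add0e//.
  apply/eqP; rewrite eq_le measure_ge0 andbT -muSC.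
  apply: le_measure; rewrite ?in_setE//;
    first [exact: measurableD|exact: measurableC|by move=> t []].
have muE b : b != 0 -> mu (hyperplane b) = mu (hyperplane a).
  move=> b0; have aa := dotv_gt0 a0; have bb := dotv_gt0 b0.
  (* Rescaling a to the length of b leaves its hyperplane unchanged and makes an orthogonal map from
     one normal to the other available. *)
  pose c := Num.sqrt (dotv b b / dotv a a).
  have c0 : c != 0 by rewrite sqrtr_eq0 -ltNge divr_gt0.
  have [|G GG Ga] := @orthogonal_map R n (c *: a) b.
    rewrite dotvZl dotvZr mulrA -expr2 sqr_sqrtr ?divfK ?gt_eqF//.
    by rewrite divr_ge0// ltW.
  rewrite -[mu (hyperplane b)]/(distribution Q theta (hyperplane b)).
  rewrite -(inv G _ GG (mH b)) -(hyperplane_scale a c0); congr (distribution Q theta _).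
  apply/seteqP; split => t;
    by rewrite /hyperplane /= cV_of_tupleK dotv_mulmx -Ga mulmxA GG mul1mx.
have mufin : mu (hyperplane a) \is a fin_num by exact: fin_num_measure.
have Nmu (N : nat) : (N%:R%:E * mu (hyperplane a) <= n%:R%:E)%E.
  have moment0 t : moment_curve n t != 0.
    by clear -a0; case: n a a0 => [a|n a _];
      [rewrite [a]flatmx0 eqxx|exact: moment_curve_neq0].
  have -> : (N%:R%:E * mu (hyperplane a))%E =
      (\sum_(j < N) \int[mu]_t (\1_(hyperplane (moment_curve n j%:R) `&` @unit_sphere n) t)%:E)%E.
    have mint (j : nat) :
        (\int[mu]_t (\1_(hyperplane (moment_curve n j%:R) `&` @unit_sphere n) t)%:E =
         mu (hyperplane a))%E.
      rewrite integral_indic; [|by []|exact: measurableI].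
      by rewrite setIT -(muE _ (moment0 j%:R)) muHS.
    under eq_bigr do rewrite mint.
    by rewrite -(fineK mufin) sumEFin sumr_const card_ord -EFinM mulr_natl.
  rewrite -ge0_integral_sum//; last first.
    move=> j; apply/measurable_EFinP; apply: measurable_indic; exact: measurableI.
  apply: (@le_trans _ _ (\int[mu]_t (cst n%:R%:E t))%E); last first.
    rewrite integral_cst// -[leRHS]mule1; apply: lee_pmul => //; exact: probability_le1.
  apply: ge0_le_integral => //.
  - by move=> t _; apply: sume_ge0.
  - apply: emeasurable_sum => j; apply/measurable_EFinP; apply: measurable_indic.
    exact: measurableI.
  - move=> t _; rewrite sumEFin lee_fin/=.
    have [St|nSt] := pselect (unit_sphere t); last first.
      rewrite big1// => j _; rewrite indicE memNset// => -[_]; exact: nSt.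
    have t0 : cV_of_tuple t != 0.
      apply: contra_eq_neq St => ->; by rewrite /dotv mulmx0 mxE eq_sym oner_neq0.
    rewrite (eq_bigr (fun j : 'I_N =>
      (dotv (moment_curve n j%:R) (cV_of_tuple t) == 0%R :> R)%:R)).
      by rewrite -natr_sum ler_nat moment_curve_count.
    move=> j _; rewrite indicE; congr (nat_of_bool _)%:R.
    apply/idP/eqP => [/set_mem[]//|Ht]; exact/mem_set.
rewrite -(fineK mufin); congr EFin; apply/eqP.
rewrite -[_ == _]negbK; apply/negP => r0.
have {r0}r0 : 0 < fine (mu (hyperplane a)) by rewrite lt_def r0 fine_ge0.
have := Nmu (Num.truncn (n%:R / fine (mu (hyperplane a)))).+1.
by rewrite -(fineK mufin) -EFinM lee_fin -ler_pdivlMr// leNgt truncnS_gt.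
Qed.

End sphere.

(** * Whitening and singular vectors *)

Section whitening.
Context (R : realType).

Lemma range_mulmx_factor m n p (A : 'M[R]_(m, n)) (B : 'M[R]_(m, p)) :
  range (fun v : 'cV[R]_n => A *m v) `<=` range (fun v : 'cV[R]_p => B *m v) ->
  exists C, A = B *m C.
Proof.
move=> AB.
have /choice[f fE] : forall i : 'I_n, exists v : 'cV[R]_p, B *m v = col i A.
  move=> i; have [v _ vE] : range (fun v : 'cV[R]_p => B *m v) (col i A).
    by apply: AB; exists (delta_mx i 0); rewrite ?colE.
  by exists v.
exists (\matrix_(i, j) f j i 0); apply/matrixP => i j.
have /matrixP/(_ i 0) := fE j; rewrite !mxE => <-.
by apply: eq_bigr => l _; rewrite !mxE.
Qed.

End whitening.

Section spectral.
Context (R : realType) (n : nat) (M : 'M[R]_n) (lam : 'rV[R]_n).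
Hypothesis MM : M *m M^T = 1%:M.
Let A := M *m diag_mx lam *m M^T.

Let MtM : M^T *m M = 1%:M. Proof. exact: mulmx1C. Qed.

Lemma conj_diag_mul_trmx : A *m A^T = M *m diag_mx (\row_i lam 0 i ^+ 2) *m M^T.
Proof.
rewrite /A !trmx_mul trmxK tr_diag_mx !mulmxA -(mulmxA _ M^T M) MtM.
rewrite mulmx1 -(mulmxA M) mulmx_diag; congr (_ *m diag_mx _ *m _).
Qed.

Lemma eigenspace_coord x (w : 'rV[R]_n) i :
  (w <= eigenspace (A *m A^T) x)%MS -> (w *m M) 0 i != 0 -> lam 0 i ^+ 2 = x.
Proof.
move=> /eigenspaceP; rewrite conj_diag_mul_trmx => wE wi.
have : w *m M *m diag_mx (\row_i lam 0 i ^+ 2) = x *: (w *m M).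
  by rewrite scalemxAl -wE -!mulmxA MtM mulmx1.
move=> /matrixP/(_ 0 i); rewrite mul_mx_diag mxE [RHS]mxE [X in _ * X]mxE.
by rewrite mulrC; apply: mulIf.
Qed.

Lemma row_trmx_neq0 i : row i M^T != 0.
Proof.
apply/eqP => /(congr1 (fun w => (w *m M) 0 i)).
rewrite -row_mul MtM mul0mx mxE [RHS]mxE mxE eqxx; apply/eqP.
exact: oner_neq0.
Qed.

Lemma row_sub_eigenspace i :
  (row i M^T <= eigenspace (A *m A^T) (lam 0 i ^+ 2))%MS.
Proof.
apply/eigenspaceP; rewrite conj_diag_mul_trmx !mulmxA -row_mul MtM.
rewrite -[in RHS](mul1mx M^T) row_mul scalemxAl; congr (_ *m _).
by rewrite mul_mx_diag; apply/rowP => j; rewrite !mxE; case: eqVneq => [->|_];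
  rewrite ?mulr1 ?mul1r ?mulr0 ?mul0r.
Qed.

(** Some coordinate i of u in the orthonormal basis of the columns of M is nonzero, so x = lam_i^2
    and column i lies in the same eigenspace, which is a line. The transposes appear because
    [eigenspace] consists of row vectors; A A^T is symmetric. *)
Lemma simple_eigenvector x (u : 'cV[R]_n) :
  \rank (eigenspace (A *m A^T) x) = 1%N -> u != 0 -> A *m A^T *m u = x *: u ->
  exists i c, u = c *: col i M /\ lam 0 i ^+ 2 = x.
Proof.
move=> rk u0 Au.
have uE : (u^T <= eigenspace (A *m A^T) x)%MS.
  apply/eigenspaceP; have -> : x *: u^T = (A *m A^T *m u)^T by rewrite Au linearZ.
  by rewrite [RHS]trmx_mul [in RHS]trmx_mul trmxK.
have [i ui] : exists i, (u^T *m M) 0 i != 0.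
  apply/existsP; apply: contraNT u0; rewrite negb_exists => /forallP uM0.
  rewrite -(trmxK u) -[u^T]mulmx1 -MM mulmxA [u^T *m M](_ : _ = 0) ?mul0mx ?trmx0//.
  by apply/rowP => i; rewrite [RHS]mxE; apply/eqP/negbNE/uM0.
have xE := eigenspace_coord uE ui.
have rE : (row i M^T <= eigenspace (A *m A^T) x)%MS by rewrite -xE row_sub_eigenspace.
have : (eigenspace (A *m A^T) x <= row i M^T)%MS.
  by rewrite -(mxrank_leqif_sup rE).2 rk rank_rV row_trmx_neq0.
move=> /(submx_trans uE)/sub_rVP[c uc]; exists i, c; split=> //.
by rewrite -(trmxK u) uc linearZ /= tr_row trmxK.
Qed.

(** By [eigenspace_coord], every coordinate other than i of an eigenvector vanishes in the basis
    M. *)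
Lemma rank_eigenspace_simple i :
  (forall j, j != i -> lam 0 j ^+ 2 != lam 0 i ^+ 2) ->
  \rank (eigenspace (A *m A^T) (lam 0 i ^+ 2)) = 1%N.
Proof.
move=> lamP; set E := eigenspace _ _.
suff /eqmxP rE : (E == row i M^T)%MS by rewrite rE rank_rV row_trmx_neq0.
rewrite row_sub_eigenspace andbT; apply/row_subP => j.
have /eigenspace_coord wE : (row j E <= E)%MS by exact: row_sub.
apply/sub_rVP; exists ((row j E *m M) 0 i).
rewrite -[LHS]mulmx1 -MM mulmxA.
rewrite [row i _]rowE scalemxAl; congr (_ *m _).
apply/rowP => l; rewrite !mxE; have [->|li] := eqVneq l i.
  by rewrite eqxx mulr1.
rewrite /= mulr0.
by apply/eqP; apply: contraTT (lamP _ li) => wl; rewrite negbK; apply/eqP/wE; rewrite mxE.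
Qed.

End spectral.

Section pseudo_inverse.
Context (R : realType).

Lemma gram_unitmx m n (A : 'M[R]_(m, n)) L : L *m A = 1%:M -> A^T *m A \in unitmx.
Proof.
move=> LA; rewrite -row_free_unit -kermx_eq0; apply/eqP/row_matrixP => i.
rewrite row0; set v := row i _.
have vA : v *m (A^T *m A) = 0 by rewrite /v -row_mul mulmx_ker row0.
have : A *m v^T = 0.
  apply/eqP; rewrite -dotv_eq0 /dotv trmx_mul trmxK mulmxA -(mulmxA v) vA.
  by rewrite mul0mx mxE.
move=> /(congr1 (mulmx L)); rewrite mulmx0 mulmxA LA mul1mx => /(congr1 trmx).
by rewrite trmxK trmx0.
Qed.

Lemma colpinvK m n (A : 'M[R]_(m, n)) L : L *m A = 1%:M -> colpinv A *m A = 1%:M.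
Proof. by move=> /gram_unitmx Au; rewrite /colpinv -mulmxA mulVmx. Qed.

Lemma trmx_colpinv m n (A : 'M[R]_(m, n)) : (colpinv A)^T = A *m invmx (A^T *m A).
Proof. by rewrite /colpinv trmx_mul trmxK trmx_inv trmx_mul trmxK. Qed.

(** The product (A^+)^T A^T is the orthogonal projection onto the range of A, so it fixes A B. *)
Lemma colpinv_proj m n p (A : 'M[R]_(m, n)) L (B : 'M[R]_(n, p)) : L *m A = 1%:M ->
  (colpinv A)^T *m (A^T *m (A *m B)) = A *m B.
Proof.
move=> /gram_unitmx Au; rewrite trmx_colpinv -!mulmxA; congr (_ *m _).
by rewrite (mulmxA A^T) (mulmxA (invmx _)) mulVmx// mul1mx.
Qed.

End pseudo_inverse.

(** * The procedure applied to moments of the form O diag O^T *)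

Section eca.
Context (R : realType) (n d : nat) (O : 'M[R]_(d, n)) (s : 'rV[R]_n).
Hypothesis O_left_inv : exists L, L *m O = 1%:M.
Hypothesis s_gt0 : forall i, 0 < s 0 i.
Hypothesis O_sum : forall i, \sum_j O j i = 1.
Let Prs := O *m diag_mx (\row_i s 0 i ^+ 2) *m O^T.
Variables (U : 'M[R]_(d, n)) (V : 'M[R]_n).
Hypothesis UV : eca_whitening Prs U V.
Let W := U *m V.

Definition whitened_topics := W^T *m O *m diag_mx s.
Let M := whitened_topics.

Lemma whitened_topics_orthogonal : M *m M^T = 1%:M.
Proof.
rewrite -UV.2 /M /whitened_topics /W /Prs !trmx_mul tr_diag_mx trmxK !mulmxA.
rewrite -(mulmxA _ (diag_mx s) (diag_mx s)) mulmx_diag.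
by rewrite trmxK.
Qed.

(** The whitening identity, bracketed so as to exhibit a left inverse of W; this makes the Gram
    matrix inside [colpinv W] invertible. *)
Let W_left_inv : (W^T *m Prs) *m W = 1%:M.
Proof. by rewrite -UV.2 /W trmx_mul !mulmxA. Qed.

Let V_unit : V \in unitmx.
Proof. by have /mulmx1_unit[] := UV.2. Qed.

Let sV2 := \row_i (s 0 i ^+ 2)^-1.

(** The range condition gives Prs = U C = W V^-1 C, and multiplying Prs on the right by L^T D^-2
    recovers O. *)
Let O_factor : exists B, O = W *m B.
Proof.
have [L LO] := O_left_inv.
have [C PC] : exists C, Prs = U *m C by apply: range_mulmx_factor; rewrite UV.1.
exists (invmx V *m C *m L^T *m diag_mx sV2).
rewrite /W !mulmxA mulmxK// -PC /Prs -(mulmxA _ O^T) -trmx_mul LO trmx1 mulmx1.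
rewrite -mulmxA mulmx_diag (_ : \row_j _ = const_mx 1) ?diag_const_mx ?mulmx1//.
by apply/rowP => i; rewrite !mxE divff// expf_neq0// gt_eqF.
Qed.

(** Since M = W^T (O D) and the columns of O lie in the range of W, the projection (W^+)^T W^T
    returns O D. *)
Lemma colpinv_whitened i : (colpinv W)^T *m col i M = s 0 i *: col i O.
Proof.
have [B OB] := O_factor.
rewrite colE mulmxA (_ : M = W^T *m (W *m (B *m diag_mx s))); last first.
  by rewrite /M /whitened_topics [in LHS]OB !mulmxA.
rewrite (colpinv_proj _ W_left_inv) !mulmxA -OB -colE.
by apply/colP => a; rewrite mul_mx_diag !mxE mulrC.
Qed.

(** Columns of O have total 1, so dividing by the total removes the scale s_i as well as c,
    including the arbitrary sign of the singular vector. *)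
Lemma normalize_colpinv_whitened i c : c != 0 ->
  (dotv (ones R d) ((colpinv W)^T *m (c *: col i M)))^-1 *:
    ((colpinv W)^T *m (c *: col i M)) = col i O.
Proof.
move=> c0; rewrite -scalemxAr colpinv_whitened !dotvZr.
rewrite (_ : dotv _ _ = 1) ?mulr1 ?scalerA; last first.
  by rewrite dotvE -[RHS](O_sum i); apply: eq_bigr => j _; rewrite !mxE mul1r.
by rewrite -mulrA mulVf ?scale1r// mulf_neq0// gt_eqF.
Qed.

(** W^T O is invertible with inverse D M^T, so its columns are independent. The values e = 1 and e =
    -1 give the normals of the exceptional hyperplanes. *)
Lemma eca_normal_neq0 i j e : j != i -> W^T *m (col j O + e *: col i O) != 0.
Proof.
move=> ji; apply/eqP.
have -> : W^T *m (col j O + e *: col i O) =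
    (W^T *m O) *m (delta_mx j 0 + e *: delta_mx i 0).
  by rewrite !colE -mulmxA mulmxDr scalemxAr.
have MtM : diag_mx s *m M^T *m (W^T *m O) = 1%:M.
  apply: mulmx1C; rewrite mulmxA; exact: whitened_topics_orthogonal.
move=> /(congr1 (mulmx (diag_mx s *m M^T))); rewrite mulmxA MtM mul1mx mulmx0.
move=> /matrixP/(_ j 0); rewrite !mxE !eqxx (negbTE ji) mulr0 addr0.
by apply/eqP; exact: oner_neq0.
Qed.

Variables (Trs : 'cV[R]_d -> 'M[R]_d) (kap : R).
Hypothesis kap_gt0 : 0 < kap.
Hypothesis TrsE : forall eta, Trs eta =
  O *m diag_mx (\row_i (kap * s 0 i ^+ 2 * (O^T *m eta) i 0)) *m O^T.
Variable theta : 'cV[R]_n.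
Let lam := \row_i (kap * (O^T *m (W *m theta)) i 0).

Let ecaE : W^T *m Trs (W *m theta) *m W = M *m diag_mx lam *m M^T.
Proof.
have diagE : diag_mx s *m diag_mx lam *m diag_mx s =
    diag_mx (\row_i (kap * s 0 i ^+ 2 * (O^T *m (W *m theta)) i 0)).
  rewrite !mulmx_diag; congr diag_mx; apply/rowP => i.
  by rewrite !mxE; move: (\sum_j _) => q; ring.
by rewrite TrsE -diagE /M /whitened_topics !trmx_mul tr_diag_mx !trmxK !mulmxA.
Qed.

Lemma left_singular_vector_eigen m p (B : 'M[R]_(m, p)) x u :
  left_singular_vector B x u -> B *m B^T *m u = x ^+ 2 *: u.
Proof.
move=> [_ _ [v [_ Bv Bu]]].
by rewrite -mulmxA Bu -scalemxAr Bv scalerA.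
Qed.

Lemma left_singular_vector_col x u :
  unique_singular_value (W^T *m Trs (W *m theta) *m W) x ->
  left_singular_vector (W^T *m Trs (W *m theta) *m W) x u ->
  exists i c, [/\ c != 0, u = c *: col i M & lam 0 i ^+ 2 = x ^+ 2].
Proof.
rewrite ecaE => -[_ rk] lsv.
have u0 : u != 0 by rewrite -dotv_eq0; case: lsv => _ -> _; exact: oner_neq0.
have [i [c [uc lamE]]] := simple_eigenvector whitened_topics_orthogonal rk u0
  (left_singular_vector_eigen lsv).
exists i, c; split=> //.
by apply: contraNneq u0 => c0; rewrite uc c0 scale0r.
Qed.

Lemma eca_output_sub S : eca_output Trs theta U V S -> S `<=` columns O.
Proof.
move=> [Lambda [[L1 _] ->]] _ [u Lu <-].
have [x [usv lsv]] := L1 u Lu.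
have [i [c [c0 -> _]]] := left_singular_vector_col usv lsv.
by exists i => //; rewrite normalize_colpinv_whitened.
Qed.

Lemma eca_output_all S :
  (forall i j, j != i ->
    (O^T *m (W *m theta)) j 0 ^+ 2 != (O^T *m (W *m theta)) i 0 ^+ 2) ->
  eca_output Trs theta U V S -> S = columns O.
Proof.
move=> distinct out; apply/seteqP; split; first exact: eca_output_sub.
move: out => [Lambda [[_ L2] ->]] _ [i _ <-].
have lamD j : j != i -> lam 0 j ^+ 2 != lam 0 i ^+ 2.
  have lamE l : lam 0 l = kap * (O^T *m (W *m theta)) l 0 by rewrite mxE.
  move=> ji; rewrite !lamE !exprMn (inj_eq (mulfI _)) ?expf_neq0 ?(lt0r_neq0 kap_gt0)//.
  exact: distinct.
(* The absolute value, because lam_i may have either sign. The vector that Lambda holds for this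
   singular value is some column j up to scale, and distinctness of the squares then forces j =
   i. *)
have usv : unique_singular_value (W^T *m Trs (W *m theta) *m W) `|lam 0 i|.
  split=> //; rewrite ecaE -normrX ger0_norm ?sqr_ge0//.
  by apply: rank_eigenspace_simple => //; exact: whitened_topics_orthogonal.
have [u [[Lu lsv] _]] := L2 _ usv.
have [j [c [c0 uc lamE]]] := left_singular_vector_col usv lsv.
have ji : j = i.
  apply/eqP; apply: contraPT lamE => /lamD /eqP; rewrite -normrX ger0_norm ?sqr_ge0//.
by exists u => //; rewrite uc ji normalize_colpinv_whitened.
Qed.

(** A difference of squares vanishes only if one of its two linear factors in theta does. *)
Lemma eca_distinct i j : 
  dotv (W^T *m (col j O - col i O)) theta != 0 ->
  dotv (W^T *m (col j O + col i O)) theta != 0 ->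
  (O^T *m (W *m theta)) j 0 ^+ 2 != (O^T *m (W *m theta)) i 0 ^+ 2.
Proof.
have colE l : (O^T *m (W *m theta)) l 0 = dotv (W^T *m col l O) theta.
  rewrite -dotv_mulmx dotvE mxE; apply: eq_bigr => a _.
  by congr (_ * _); rewrite !mxE.
rewrite mulmxBr mulmxDr dotvBl (dotvC (_ + _)) dotvDr !(dotvC theta) !colE => d1 d2.
by rewrite -subr_eq0 subr_sqr mulf_neq0.
Qed.

End eca.

Lemma uniform_ae_off_hyperplane (R : realType) n (dT : measure_display)
    (T : measurableType dT) (Q : probability T R) (theta : {RV Q >-> n.-tuple R})
    (a : 'cV[R]_n) : uniform_on_sphere theta -> a != 0 ->
  {ae Q, forall t, dotv a (cV_of_tuple (theta t)) != 0}.
Proof.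
move=> unif a0; exists (theta @^-1` hyperplane a); split.
- rewrite -[X in measurable X]setTI; apply: (measurable_funP theta) => //.
  exact: measurable_hyperplane.
- exact: uniform_hyperplane0 unif a0.
- by move=> t /= /negP; rewrite negbK => /eqP.
Qed.

(* The number of topics is k = n.+1. *)
Theorem theorem4p3 (R : realType) (n d : nat)
    (alpha : 'I_n.+1 -> R) (O : 'M[R]_(d, n.+1))
    (dO : measure_display) (Omega : measurableType dO)
    (P : probability Omega R) (h : {RV P >-> n.+1.-tuple R})
    (z : nat -> Omega -> 'I_n.+1) (y : nat -> Omega -> 'I_d)
    (alpha_gt0 : forall i, 0 < alpha i)
    (le_kd : (n.+1 <= d)%N)
    (O_topic : topic_matrix O)
    (h_dirichlet : dirichlet_distributed alpha h)
    (xh : lda_sampling O h z y) :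
  let alpha0 := \sum_i alpha i in
  let x := observation R y in
  let Prs := Pairs P x alpha0 in
  let Trs := Triples P x alpha0 in
  [/\ forall (theta : 'cV[R]_n.+1) (U : 'M[R]_(d, n.+1)) (V : 'M[R]_n.+1)
             (S : set 'cV[R]_d),
        eca_whitening Prs U V -> eca_output Trs theta U V S ->
        S `<=` columns O,
      forall (dT : measure_display) (T : measurableType dT)
             (Q : probability T R) (theta : {RV Q >-> n.+1.-tuple R})
             (U : 'M[R]_(d, n.+1)) (V : 'M[R]_n.+1),
        uniform_on_sphere theta -> eca_whitening Prs U V ->
        {ae Q, forall t, forall S : set 'cV[R]_d,
           eca_output Trs (cV_of_tuple (theta t)) U V S -> S = columns O} &
      \col_i alpha i =
        (alpha0 * (alpha0 + 1)) *:
          (colpinv O *m Prs *m (colpinv O)^T *m ones R n.+1)].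
Proof.
move=> alpha0 x Prs Trs.
have A0 : 0 < alpha0.
  by rewrite /alpha0 big_ord_recl ltr_pwDl// sumr_ge0// => i _; exact: ltW.
have O_inv : exists L, L *m O = 1%:M.
  by apply/row_fullP; rewrite /row_full O_topic.1.
(* The diagonal of D: D^2 is the diagonal factor of Pairs. *)
pose s := \row_i Num.sqrt (alpha i / (alpha0 * (alpha0 + 1))).
have s2 i : s 0 i ^+ 2 = alpha i / (alpha0 * (alpha0 + 1)).
  by rewrite mxE sqr_sqrtr// divr_ge0 ?mulr_ge0 ?addr_ge0 ?ltW.
have s_gt0 i : 0 < s 0 i by rewrite mxE sqrtr_gt0 divr_gt0 ?mulr_gt0 ?addr_gt0.
have PrsE : Prs = O *m diag_mx (\row_i s 0 i ^+ 2) *m O^T.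
  rewrite /Prs (PairsE alpha_gt0 h_dirichlet xh O_topic); congr (_ *m diag_mx _ *m _).
  by apply/rowP => i; rewrite [LHS]mxE [RHS]mxE s2.
(* This is the ratio of the diagonal of Triples at eta to D^2 diag(O^T eta). *)
have kap_gt0 : 0 < 2 / (alpha0 + 2) by rewrite divr_gt0 ?addr_gt0.
have TrsE eta : Trs eta =
    O *m diag_mx (\row_i (2 / (alpha0 + 2) * s 0 i ^+ 2 * (O^T *m eta) i 0)) *m O^T.
  rewrite /Trs (TriplesE alpha_gt0 h_dirichlet xh O_topic).
  congr (_ *m diag_mx _ *m _); apply/rowP => i; rewrite [LHS]mxE [RHS]mxE s2.
  suff H (A a q : R) : 0 < A ->
      2 * a * q / (A * (A + 1) * (A + 2)) = 2 / (A + 2) * (a / (A * (A + 1))) * q.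
    exact: H.
  by move=> A1; field; rewrite !gt_eqF ?addr_gt0.
have O_sum i : \sum_j O j i = 1 by exact: (O_topic.2 i).2.
split.
- move=> theta U V S; rewrite PrsE => UV.
  exact: (eca_output_sub O_inv s_gt0 O_sum UV TrsE).
- move=> dT T Q theta U V unif; rewrite PrsE => UV.
  (* The exceptional set depends on theta through finitely many pairs of topics, and not on S, so
     one null set serves every possible output. *)
  have : {ae Q, forall t, forall ij : 'I_n.+1 * 'I_n.+1, ij.2 != ij.1 ->
      (O^T *m (U *m V *m cV_of_tuple (theta t))) ij.2 0 ^+ 2 !=
      (O^T *m (U *m V *m cV_of_tuple (theta t))) ij.1 0 ^+ 2}.
    apply: filter_forall => -[i j] /=.
    have [->|ji] := eqVneq j i; first by apply: filterE => t; rewrite eqxx.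
    have normal := eca_normal_neq0 UV.
    have := uniform_ae_off_hyperplane unif (normal i j (-1) ji).
    have := uniform_ae_off_hyperplane unif (normal i j 1 ji).
    apply: filterS2 => t; rewrite scaleN1r scale1r => dD dB _.
    exact: eca_distinct.
  apply: filterS => t distinct S.
  apply: (eca_output_all O_inv s_gt0 O_sum UV kap_gt0 TrsE) => i j ji.
  exact: (distinct (i, j)).
(* O^+ O = 1 reduces the product to D^2, whose row sums are alpha_i / (alpha0 (alpha0 + 1)). *)
- have [L LO] := O_inv; have OO := colpinvK LO.
  rewrite PrsE !mulmxA OO mul1mx -(mulmxA _ O^T) -trmx_mul OO trmx1 mulmx1.
  apply/colP => i; rewrite [LHS]mxE.
  have -> : diag_mx (\row_i s 0 i ^+ 2) *m ones R n.+1 =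
      \col_i (alpha i / (alpha0 * (alpha0 + 1))).
    apply/colP => j; rewrite mul_diag_mx [LHS]mxE [RHS]mxE [ones _ _ _ _]mxE mulr1.
    by rewrite [LHS]mxE s2.
  by rewrite [RHS]mxE [X in _ * X]mxE mulrC divfK// mulf_neq0 ?gt_eqF// addr_gt0.
Qed.
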